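(* Let $f:\Sigma\to\mathbb{R}^3$ be a front with unit normal $\nu$ and let $p\in\Sigma$ be a non-degenerate singular point of $f$. Fix an adapted coordinate system centered at $p$, with its null vector field $\eta$, and let $\kappa_\pm$ be the associated principal curvatures. (1) Let $p$ be a cuspidal edge. If $\eta\lambda(p)\,\kappa_c(p)>0$, then $\kappa_+$ is a bounded $C^\infty$-function at $p$; moreover $\kappa_+(p)=\kappa_\nu(p)$. Conversely, if $\kappa_+$ is a bounded $C^\infty$-function at $p$, then $\eta\lambda(p)\,\kappa_c(p)>0$. (2) Let $p$ be of the second kind. If $\mu_c(p)>0$, then $\kappa_+$ is a bounded $C^\infty$-function at $p$; moreover $\kappa_+(p)=\kappa_\nu(p)$ if $p$ is admissible. Conversely, if $\kappa_+$ is a bounded $C^\infty$-function at $p$, then $\mu_c(p)>0$. Moreover, if one of $\kappa_+,\kappa_-$ is bounded at $p$, then the other is unbounded at $p$.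
   Context: All maps are $C^\infty$. $\Sigma\subset\mathbb{R}^2$ is a domain. A map $f:\Sigma\to\mathbb{R}^3$ is a frontal if there is a unit normal vector $\nu:\Sigma\to S^2$ (orthogonal to the image of $df$ everywhere); it is a front if moreover $(f,\nu):\Sigma\to\mathbb{R}^3\times S^2$ is an immersion. $S(f)$ is the set of points where $f$ is not an immersion. The signed area density is $\lambda=\det(f_u,f_v,\nu)$, so $S(f)=\lambda^{-1}(0)$. A point $p\in S(f)$ is non-degenerate if $d\lambda(p)\ne0$; then near $p$, $S(f)$ is a regular curve $\gamma$ (the singular curve, $\gamma(0)=p$), and there is a non-vanishing vector field $\eta$ (null vector field) with $df(\eta)=0$ along $\gamma$. A non-degenerate singular point $p$ is of the first kind if $\eta$ is transverse to $\gamma'$ at $p$, otherwise of the second kind; a second-kind point is admissible if the singular points on $\gamma$ near $p$ other than $p$ are of the first kind. A cuspidal edge is a point where the germ of $f$ is $\mathcal{A}$-equivalent (equal up to diffeomorphism germs of source and target) to $(u,v)\mapsto(u,v^2,v^3)$ at $0$; for fronts this is the same as a non-degenerate singular point of the first kind. Adapted coordinates. A coordinate system $(U;u,v)$ centered at $p$, compatible with the orientation of $\Sigma$, is adapted if the $u$-axis is the singular curve, there are no singular points off the $u$-axis, and on the $u$-axis the null vector field is $\eta=\partial_v$ ($p$ of the first kind), respectively $\eta=\partial_u+\epsilon(u)\partial_v$ with $\epsilon(0)=0$ ($p$ of the second kind). $U$ is taken small enough that the expressions below make sense. Cuspidal edge. There is $\varphi:U\to\mathbb{R}^3\setminus\{0\}$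 with $f_v=v\varphi$, and $f_u,\varphi,\nu$ are linearly independent. Put $\widetilde E=\|f_u\|^2$, $\widetilde F=\langle f_u,\varphi\rangle$, $\widetilde G=\|\varphi\|^2$, $\widetilde L=-\langle f_u,\nu_u\rangle$, $\widetilde M=-\langle\varphi,\nu_u\rangle$, $\widetilde N=-\langle\varphi,\nu_v\rangle$, and $D=\widetilde E\widetilde G-\widetilde F^2$, $\widetilde A=\widetilde E\widetilde N-2v\widetilde F\widetilde M+v\widetilde G\widetilde L$, $\widetilde B=\sqrt{\widetilde A^2-4vD(\widetilde L\widetilde N-v\widetilde M^2)}$. The principal curvatures on $U\setminus\{v=0\}$ are $$\kappa_+=\frac{2(\widetilde L\widetilde N-v\widetilde M^2)}{\widetilde A+\widetilde B}=\frac{\widetilde A-\widetilde B}{2vD},\qquad \kappa_-=\frac{2(\widetilde L\widetilde N-v\widetilde M^2)}{\widetilde A-\widetilde B}=\frac{\widetilde A+\widetilde B}{2vD}$$ (the second expressions being used where the first have vanishing denominators). Along the $u$-axis the limiting normal curvature and the cuspidal curvature are $$\kappa_\nu=\frac{\langle f_{uu},\nu\rangle}{\|f_u\|^2},\qquad \kappa_c=\frac{\|f_u\|^{3/2}\det(f_u,\varphi,f_{vvv})}{\|f_u\times\varphi\|^{5/2}}.$$ Second kind. There is $\varphi:U\to\mathbb{R}^3\setminus\{0\}$ with $f_u+\epsilon(u)f_v=v\varphi$, and $\varphi,f_v,\nu$ are linearly independent. Put $\widehat E=\|\varphi\|^2$, $\widehat F=\langle\varphi,f_v\rangle$, $\widehat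 G=\|f_v\|^2$, $\widehat L=-\langle\varphi,\nu_u\rangle$, $\widehat M=-\langle\varphi,\nu_v\rangle$, $\widehat N=-\langle f_v,\nu_v\rangle$, and $\widehat D=\widehat E\widehat G-\widehat F^2$, $\widehat Q=(\widehat L+\epsilon\widehat M)\widehat N-v\widehat M^2$, $\widehat A=\widehat G(\widehat L+\epsilon\widehat M)-2v\widehat F\widehat M+v\widehat E\widehat N$, $\widehat B=\sqrt{\widehat A^2-4v\widehat D\widehat Q}$. The principal curvatures on $U\setminus\{v=0\}$ are $$\kappa_+=\frac{2\widehat Q}{\widehat A+\widehat B}=\frac{\widehat A-\widehat B}{2v\widehat D},\qquad \kappa_-=\frac{2\widehat Q}{\widehat A-\widehat B}=\frac{\widehat A+\widehat B}{2v\widehat D}$$ (same convention). With $H$ the mean curvature of $f$, $\widehat H=vH$ extends smoothly to $U$, and the normalized cuspidal curvature is $\mu_c(p)=2\widehat H(p)=\widehat G(p)\widehat L(p)/\|\varphi(p)\times f_v(p)\|^2$. If $p$ is admissible, $\kappa_\nu(p)$ denotes the limit, as $q\to p$ along the singular curve, of the limiting normal curvature at the first-kind singular points $q$, given for a parametrization $\gamma$ of the singular curve by $\langle (f\circ\gamma)'',\nu\circ\gamma\rangle/\|(f\circ\gamma)'\|^2$. ''$\kappa_+$ is a bounded $C^\infty$-function at $p$'' means that it extends across $\{v=0\}$ to a $C^\infty$-function on a neighbourhood of $p$; $\kappa_+(p)$ is the value of the extension. ''Unbounded at $p$'' means unbounded on every neighbourhood of $p$ (minus $\{v=0\}$). 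*)

(* Defs.v *)
From HB Require Import structures.
From mathcomp Require Import all_boot all_order all_algebra.
From mathcomp Require Import all_classical all_reals all_analysis.

Set Implicit Arguments.
Unset Strict Implicit.
Unset Printing Implicit Defensive.

Import Order.TTheory GRing.Theory Num.Theory.
Import numFieldNormedType.Exports.

Local Open Scope classical_set_scope.
Local Open Scope ring_scope.

Section Smoothness.
Context {R : realType}.

(* Only used on open sets [U] of finite-dimensional spaces, where continuity
   of all directional derivatives is the usual notion of class C^k. *)
Fixpoint Ck (W V : normedModType R) (k : nat) (U : set W) (g : W -> V) : Prop :=
  match k with
  | 0%N => forall z, U z -> {for z, continuous g}
  | k'.+1 => (forall z, U z -> differentiable g z) /\
             (forall w, Ck k' U (fun z => 'D_w g z))
  end.

Definition smooth_on (W V : normedModType R) (U : set W) (g : W -> V) : Prop :=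
  forall k, Ck k U g.

Definition immersion_at (W V : normedModType R) (g : W -> V) (z : W) : Prop :=
  injective ('d g z : W -> V).

Definition diffeo (W : normedModType R) (U V : set W) (x y : W -> W) : Prop :=
  [/\ open U /\ open V,
      smooth_on U x /\ smooth_on V y,
      (forall z, U z -> V (x z) /\ y (x z) = z) &
      (forall q, V q -> U (y q) /\ x (y q) = q)].

Definition A_equivalent (W V : normedModType R)
    (f : W -> V) (p : W) (g : W -> V) (q : W) : Prop :=
  exists (U1 U2 : set W) (x y : W -> W) (V1 V2 : set V) (X Y : V -> V),
    [/\ diffeo U1 U2 x y, U1 q /\ x q = p,
        diffeo V1 V2 X Y, V1 (f p) /\ X (f p) = g q &
        \forall z \near q, X (f (x z)) = g z].

End Smoothness.

Section Euclidean.
Context {R : realType}.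

(* The library norm on row vectors is the sup norm, hence [enorm]. *)
Definition dot (a b : 'rV[R]_3) : R := \sum_(i < 3) a 0 i * b 0 i.
Definition enorm (a : 'rV[R]_3) : R := Num.sqrt (dot a a).

Definition rows3 (a b c : 'rV[R]_3) : 'M[R]_3 :=
  \matrix_(i < 3) nth 0 [:: a; b; c] i.
Definition det3 (a b c : 'rV[R]_3) : R := \det (rows3 a b c).
Definition cross (a b : 'rV[R]_3) : 'rV[R]_3 :=
  \row_(k < 3) det3 a b (delta_mx 0 k).

Definition eu : 'rV[R]_2 := delta_mx 0 0.
Definition ev : 'rV[R]_2 := delta_mx 0 1.

Definition pu (V : normedModType R) (g : 'rV[R]_2 -> V) : 'rV[R]_2 -> V :=
  fun z => 'D_eu g z.
Definition pv (V : normedModType R) (g : 'rV[R]_2 -> V) : 'rV[R]_2 -> V :=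
  fun z => 'D_ev g z.

Definition ucoord (z : 'rV[R]_2) : R := z 0 0.
Definition vcoord (z : 'rV[R]_2) : R := z 0 1.

End Euclidean.

Section Fronts.
Context {R : realType}.
Implicit Types (f nu : 'rV[R]_2 -> 'rV[R]_3) (Sigma : set 'rV[R]_2).

Definition frontal Sigma f nu : Prop :=
  [/\ smooth_on Sigma f, smooth_on Sigma nu &
      forall z, Sigma z ->
        dot (nu z) (nu z) = 1 /\ forall w, dot ('d f z w) (nu z) = 0].

Definition front Sigma f nu : Prop :=
  frontal Sigma f nu /\
  forall z, Sigma z -> immersion_at (fun z' => (f z', nu z')) z.

Definition singular_set Sigma f : set 'rV[R]_2 :=
  [set z | Sigma z /\ ~ immersion_at f z].

Definition lambda f nu : 'rV[R]_2 -> R :=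
  fun z => det3 (pu f z) (pv f z) (nu z).

Definition nondegenerate_singular Sigma f nu (p : 'rV[R]_2) : Prop :=
  singular_set Sigma f p /\ exists w, 'd (lambda f nu) p w != 0.

Definition singular_curve Sigma f (q : 'rV[R]_2) (e : R)
    (gamma : R -> 'rV[R]_2) : Prop :=
  [/\ 0 < e /\ smooth_on `]-e, e[%classic gamma,
      gamma 0 = q,
      (forall t, `]-e, e[%classic t -> (gamma^`())%classic t != 0) &
      \forall z \near q,
        singular_set Sigma f z <-> exists2 t, `]-e, e[%classic t & gamma t = z].

Definition null_field f (e : R) (gamma eta : R -> 'rV[R]_2) : Prop :=
  smooth_on `]-e, e[%classic eta /\
  forall t, `]-e, e[%classic t -> eta t != 0 /\ 'd f (gamma t) (eta t) = 0.

Definition first_kind Sigma f nu (q : 'rV[R]_2) : Prop :=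
  nondegenerate_singular Sigma f nu q /\
  exists (e : R) (gamma eta : R -> 'rV[R]_2),
    [/\ singular_curve Sigma f q e gamma, null_field f e gamma eta &
        row_free (col_mx ((gamma^`())%classic 0) (eta 0))].

Definition second_kind Sigma f nu (q : 'rV[R]_2) : Prop :=
  nondegenerate_singular Sigma f nu q /\ ~ first_kind Sigma f nu q.

Definition admissible Sigma f nu (p : 'rV[R]_2) : Prop :=
  second_kind Sigma f nu p /\
  \forall q \near p,
    singular_set Sigma f q -> q != p -> first_kind Sigma f nu q.

Definition cuspidal_edge f (p : 'rV[R]_2) : Prop :=
  A_equivalent f p
    (fun z => \row_(i < 3) nth 0 [:: ucoord z; vcoord z ^+ 2; vcoord z ^+ 3] i)
    0.

(* [x] is the inverse of the coordinate map [y = (u, v)]. *)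
Definition oriented_chart Sigma (p : 'rV[R]_2)
    (U V : set 'rV[R]_2) (x y : 'rV[R]_2 -> 'rV[R]_2) : Prop :=
  [/\ diffeo U V x y, U 0 /\ x 0 = p, V `<=` Sigma &
      forall z, U z -> 0 < \det (jacobian x z)].

End Fronts.

(* From here on [g] and [n] are the expressions of the front and of its unit
   normal in the coordinates (u, v), defined on [U]. *)
Section AdaptedCoordinates.
Context {R : realType}.
Implicit Types (U : set 'rV[R]_2) (g n phi : 'rV[R]_2 -> 'rV[R]_3).

Definition adapted U g (eta : 'rV[R]_2 -> 'rV[R]_2) : Prop :=
  (forall z, U z -> (~ immersion_at g z <-> vcoord z = 0)) /\
  (forall z, U z -> vcoord z = 0 -> 'd g z (eta z) = 0).

Definition adapted_first U g n phi : Prop :=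
  [/\ adapted U g (fun=> ev), smooth_on U phi &
      forall z, U z ->
        [/\ phi z != 0, pv g z = vcoord z *: phi z &
            row_free (rows3 (pu g z) (phi z) (n z))]].

Definition adapted_second U g n (eps : R -> R) phi : Prop :=
  [/\ smooth_on (ucoord @` U) eps /\ eps 0 = 0,
      adapted U g (fun z => eu + eps (ucoord z) *: ev),
      smooth_on U phi &
      forall z, U z ->
        [/\ phi z != 0,
            pu g z + eps (ucoord z) *: pv g z = vcoord z *: phi z &
            row_free (rows3 (phi z) (pv g z) (n z))]].

Definition Broot (v A D Q : R) : R := Num.sqrt (A ^+ 2 - 4 * v * D * Q).

Definition kappa_plus_of (v A D Q : R) : R :=
  let B := Broot v A D Q in
  if A + B != 0 then 2 * Q / (A + B) else (A - B) / (2 * v * D).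

Definition kappa_minus_of (v A D Q : R) : R :=
  let B := Broot v A D Q in
  if A - B != 0 then 2 * Q / (A - B) else (A + B) / (2 * v * D).

Section FirstKind.
Variables (g n phi : 'rV[R]_2 -> 'rV[R]_3).

Definition tE z := enorm (pu g z) ^+ 2.
Definition tF z := dot (pu g z) (phi z).
Definition tG z := enorm (phi z) ^+ 2.
Definition tL z := - dot (pu g z) (pu n z).
Definition tM z := - dot (phi z) (pu n z).
Definition tN z := - dot (phi z) (pv n z).
Definition tD z := tE z * tG z - tF z ^+ 2.
Definition tQ z := tL z * tN z - vcoord z * tM z ^+ 2.
Definition tA z :=
  tE z * tN z - 2 * vcoord z * tF z * tM z + vcoord z * tG z * tL z.

Definition kappa_plus_first z := kappa_plus_of (vcoord z) (tA z) (tD z) (tQ z).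
Definition kappa_minus_first z :=
  kappa_minus_of (vcoord z) (tA z) (tD z) (tQ z).

Definition kappa_nu_first z := dot (pu (pu g) z) (n z) / enorm (pu g z) ^+ 2.

Definition kappa_c z :=
  enorm (pu g z) `^ (3 / 2) * det3 (pu g z) (phi z) (pv (pv (pv g)) z)
  / enorm (cross (pu g z) (phi z)) `^ (5 / 2).

End FirstKind.

Section SecondKind.
Variables (g n : 'rV[R]_2 -> 'rV[R]_3) (eps : R -> R).
Variable phi : 'rV[R]_2 -> 'rV[R]_3.

Definition hE z := enorm (phi z) ^+ 2.
Definition hF z := dot (phi z) (pv g z).
Definition hG z := enorm (pv g z) ^+ 2.
Definition hL z := - dot (phi z) (pu n z).
Definition hM z := - dot (phi z) (pv n z).
Definition hN z := - dot (pv g z) (pv n z).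
Definition hD z := hE z * hG z - hF z ^+ 2.
Definition hQ z :=
  (hL z + eps (ucoord z) * hM z) * hN z - vcoord z * hM z ^+ 2.
Definition hA z :=
  hG z * (hL z + eps (ucoord z) * hM z)
  - 2 * vcoord z * hF z * hM z + vcoord z * hE z * hN z.

Definition kappa_plus_second z := kappa_plus_of (vcoord z) (hA z) (hD z) (hQ z).
Definition kappa_minus_second z :=
  kappa_minus_of (vcoord z) (hA z) (hD z) (hQ z).

End SecondKind.

Definition mean_curvature g n (z : 'rV[R]_2) : R :=
  let E := dot (pu g z) (pu g z) in
  let F := dot (pu g z) (pv g z) in
  let G := dot (pv g z) (pv g z) in
  let L := - dot (pu g z) (pu n z) in
  let M := - dot (pu g z) (pv n z) in
  let N := - dot (pv g z) (pv n z) in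
  (E * N - 2 * F * M + G * L) / (2 * (E * G - F ^+ 2)).

Definition curve_kappa_nu g n (c : R -> 'rV[R]_2) (t : R) : R :=
  dot (((g \o c)^`(2))%classic t) (n (c t))
  / enorm (((g \o c)^`())%classic t) ^+ 2.

Definition smooth_extension (h k : 'rV[R]_2 -> R) : Prop :=
  exists W : set 'rV[R]_2,
    [/\ open W, W 0, smooth_on W k &
        forall z, W z -> vcoord z != 0 -> k z = h z].

Definition bounded_smooth (h : 'rV[R]_2 -> R) : Prop :=
  exists k, smooth_extension h k.

(* If [h] has a smooth extension across [v = 0], then all its extensions have
   the same value at the origin. *)
Definition value_at_origin (h : 'rV[R]_2 -> R) : R :=
  xget (fun=> 0) [set k | smooth_extension h k] 0.

Definition bounded_at_origin (h : 'rV[R]_2 -> R) : Prop :=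
  exists M, \forall z \near (0 : 'rV[R]_2), vcoord z != 0 -> `|h z| <= M.

Definition unbounded_at_origin (h : 'rV[R]_2 -> R) : Prop :=
  forall W : set 'rV[R]_2, nbhs (0 : 'rV[R]_2) W ->
  forall M, exists z, [/\ W z, vcoord z != 0 & M < `|h z|].

Definition mu_c g n : R :=
  2 * value_at_origin (fun z => vcoord z * mean_curvature g n z).

End AdaptedCoordinates.

(* Main.v *)
(* Write kappa_+ and kappa_- off the axis [v = 0] as (A -/+ B) / (2 v D) with
   B = sqrt (A^2 - 4 v D Q).  On the axis B = |A|, and A(0) <> 0 because [f] is a
   front: the normal moves in the null direction, its derivative n_eta is
   orthogonal to n, and by the symmetry of the second fundamental form it is
   orthogonal to one of the two tangent directions as well, so it has a non-zero
   component along phi.  If A(0) > 0, then kappa_+ = 2 Q / (A + B) is smooth near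
   0 with value Q(0) / A(0), and the numerator A + B makes kappa_- blow up; if
   A(0) < 0, then kappa_+ blows up.  It remains to read off the sign of A(0): in
   the first kind A(0) = E N is a positive multiple of (eta lambda) kappa_c, and
   in the second kind v H = A / (2 D) off the axis, hence mu_c = A(0) / D(0).
   Admissibility enters only through [eps t <> 0] for small t <> 0: where eps
   vanishes, the null direction is tangent to the singular curve. *)
Require Import Defs.
From HB Require Import structures.
From mathcomp Require Import all_boot all_order all_algebra.
From mathcomp Require Import all_classical all_reals all_analysis.
From mathcomp Require Import ring lra.

Import Order.TTheory GRing.Theory Num.Theory.
Import numFieldNormedType.Exports.

Local Open Scope classical_set_scope.
Local Open Scope ring_scope.

Set Implicit Arguments.
Unset Strict Implicit.

(** * Calculus of smooth maps *)

Section SmoothCalculus.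
Context {R : realType}.

(** The first-order expansion of [f] at [x] is also one of [g], and uniqueness of the linear part
    identifies the two differentials. *)
Lemma near_eq_differentiable (V W : normedModType R) (f g : V -> W) (x : V) :
  (\forall z \near x, f z = g z) -> differentiable f x -> differentiable g x.
Proof.
move=> fg df; apply/diff_locallyP.
have fgx : f x = g x by exact: nbhs_singleton fg.
have dfc := diff_continuous df.
have gE : g \o shift x = cst (g x) + 'd f x +o_ 0 id.
  have /diff_locally/eqaddoP fe := df.
  apply/eqaddoP => e e0; have := fe e e0.
  apply: filter_app; move: fg; rewrite (near_shift 0 x) => fg.
  near=> h; have : f (h + x) = g (h + x) by near: h; move: fg;
    apply: filterS => h /=; rewrite subr0.
  by rewrite !fctE /= fgx => ->.
by have -> := diff_unique dfc gE.
Unshelve. all: by end_near. Qed.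

Lemma near_eqD (V W : normedModType R) (f g : V -> W) (x w : V) :
  (\forall z \near x, f z = g z) -> 'D_w f x = 'D_w g x.
Proof.
(* [near_eq_derive] is stated for a non-zero direction; along 0 both derivatives vanish. *)
move=> fg; have [->|w0] := eqVneq w 0; first by rewrite !derive0.
exact: near_eq_derive.
Qed.

Section Ck_basics.
Context {W : normedModType R} {U : set W} (oU : open U).

(** Openness turns agreement on [U] into agreement near each point of [U], hence into agreement of
    all derivatives. In the inductions below this replaces a derivative by the formula that computes
    it. *)
Lemma Ck_ext (V : normedModType R) k (g h : W -> V) :
  (forall z, U z -> g z = h z) -> Ck k U g -> Ck k U h.
Proof.
elim: k g h => [|k IH] g h gh /=.
  move=> cg z Uz; have /(filterS gh) gh_near : nbhs z U by exact: open_nbhs_nbhs.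
  have cgz : g @ z --> h z by rewrite -(gh z Uz); exact: cg.
  apply: cvg_trans cgz; exact: near_eq_cvg.
case=> dg Cg; have near_gh z : U z -> \forall y \near z, g y = h y.
  move=> Uz; have : nbhs z U by exact: open_nbhs_nbhs.
  by apply: filterS.
split=> [z Uz|w]; first exact: near_eq_differentiable (near_gh _ Uz) (dg z Uz).
by apply: IH (Cg w) => z Uz; apply: near_eqD; exact: near_gh.
Qed.

Lemma CkS (V : normedModType R) k (g : W -> V) : Ck k.+1 U g -> Ck k U g.
Proof.
elim: k g => [|k IH] g /= [dg Cg].
  by move=> z Uz; apply: differentiable_continuous; exact: dg.
by split=> // w; apply: IH; exact: Cg.
Qed.

Lemma Ck_cst (V : normedModType R) k (c : V) : Ck k U (fun=> c).
Proof.
elim: k c => [|k IH] c /=; first by move=> z _; exact: cvg_cst.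
split=> [z _|w]; first exact: differentiable_cst.
by apply: Ck_ext (IH 0) => z _; rewrite derive_cst.
Qed.

Lemma CkD (V : normedModType R) k (g h : W -> V) :
  Ck k U g -> Ck k U h -> Ck k U (fun z => g z + h z).
Proof.
elim: k g h => [|k IH] g h /=.
  by move=> cg ch z Uz; apply: cvgD; [exact: cg|exact: ch].
case=> dg Cg [dh Ch]; split=> [z Uz|w].
  by apply: differentiableD; [exact: dg|exact: dh].
apply: Ck_ext (IH _ _ (Cg w) (Ch w)) => z Uz.
by rewrite -deriveD//; apply: diff_derivable; [exact: dg|exact: dh].
Qed.

Lemma derive_lin (V V' : normedModType R) (L : {linear V -> V'}) (g : W -> V)
  (z w : W) : continuous L -> differentiable g z ->
  'D_w (fun z => L (g z)) z = L ('D_w g z).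
Proof.
move=> cL dg; have dL : differentiable L (g z) by exact: linear_differentiable.
rewrite !deriveE//; last exact: (differentiable_comp dg dL).
by rewrite (diff_comp dg dL) /= diff_lin.
Qed.

Lemma Ck_lin (V V' : normedModType R) (L : {linear V -> V'}) k (g : W -> V) :
  continuous L -> Ck k U g -> Ck k U (fun z => L (g z)).
Proof.
move=> cL; elim: k g => [|k IH] g /=.
  move=> cg z Uz; apply: (@continuous_comp _ _ _ g L); first exact: cg.
  exact: cL.
case=> dg Cg; split=> [z Uz|w].
  apply: (@differentiable_comp _ _ _ _ g L); first exact: dg.
  exact: linear_differentiable.
by apply: Ck_ext (IH _ (Cg w)) => z Uz; rewrite derive_lin//; exact: dg.
Qed.

Lemma CkM k (g h : W -> R) :
  Ck k U g -> Ck k U h -> Ck k U (fun z => g z * h z).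
Proof.
elim: k g h => [|k IH] g h.
  by move=> cg ch z Uz; apply: cvgM; [exact: cg|exact: ch].
move=> /[dup] /CkS Cg' [dg Cg] /[dup] /CkS Ch' [dh Ch]; split=> [z Uz|w].
  by apply: differentiableM; [exact: dg|exact: dh].
apply: (Ck_ext (g := fun z => g z * 'D_w h z + h z * 'D_w g z)).
  move=> z Uz; rewrite -[RHS]/('D_w (g * h) z) deriveM//.
  - exact/diff_derivable/dg.
  - exact/diff_derivable/dh.
by apply: CkD; apply: IH => //; [exact: Ch|exact: Cg].
Qed.

Lemma CkN (V : normedModType R) k (g : W -> V) :
  Ck k U g -> Ck k U (fun z => - g z).
Proof.
move=> Cg; apply: (Ck_ext (g := fun z => -1 *: g z)).
  by move=> z _; rewrite scaleN1r.
apply: (@Ck_lin V V (-1 \*: idfun)) => // y; exact: scaler_continuous.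
Qed.

Lemma CkB (V : normedModType R) k (g h : W -> V) :
  Ck k U g -> Ck k U h -> Ck k U (fun z => g z - h z).
Proof. by move=> Cg Ch; apply: CkD => //; exact: CkN. Qed.

Lemma CkX k n (g : W -> R) : Ck k U g -> Ck k U (fun z => g z ^+ n).
Proof.
move=> Cg; elim: n => [|n IH]; first exact: Ck_cst.
by apply: (Ck_ext _ (CkM Cg IH)) => z _; rewrite exprS.
Qed.

(** The derivative of [g^-1] is a polynomial in [g^-1] and ['D_w g], so each order of
    differentiability calls only on the previous one for [g^-1]. *)
Lemma CkV k (g : W -> R) : (forall z, U z -> g z != 0) ->
  Ck k U g -> Ck k U (fun z => (g z)^-1).
Proof.
move=> g0; elim: k => [|k IH].
  by move=> cg z Uz; apply: cvgV; [exact: g0|exact: cg].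
move=> /[dup] /CkS /IH IHg [dg Cg]; split=> [z Uz|w].
  by apply: differentiableV; [exact: dg|exact: g0].
apply: (Ck_ext (g := fun z => - ((g z)^-1 * (g z)^-1 * 'D_w g z))).
  move=> z Uz; rewrite deriveV ?g0//; last exact/diff_derivable/dg.
  by rewrite scaleNr expr2 invfM.
by apply: CkN; apply: CkM; [exact: CkM|exact: Cg].
Qed.

Lemma derive_comp1 (V : normedModType R) (f : R -> V) (g : W -> R) (z w : W) :
  differentiable g z -> differentiable f (g z) ->
  'D_w (fun y => f (g y)) z = 'D_w g z *: 'D_1 f (g z).
Proof.
move=> dg df; have dfg : differentiable (f \o g) z by exact: differentiable_comp.
rewrite -[LHS]/('D_w (f \o g) z) !deriveE// diff_comp//=.
by rewrite -[X in 'd f (g z) X = _]mulr1 -[_ * 1]/(_ *: _) linearZ.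
Qed.

(** Same bootstrapping as for the inverse: the derivative of the root is ['D_w g] divided by twice
    the root. *)
Lemma Ck_sqrt k (g : W -> R) : (forall z, U z -> 0 < g z) ->
  Ck k U g -> Ck k U (fun z => Num.sqrt (g z)).
Proof.
move=> g0; elim: k => [|k IH].
  move=> cg z Uz; apply: (@continuous_comp _ _ _ g); first exact: cg.
  exact: sqrt_continuous.
have dsqrt z : U z -> is_derive (g z) 1 Num.sqrt (2 * Num.sqrt (g z))^-1.
  by move=> Uz; apply: is_derive1_sqrt; exact: g0.
move=> /[dup] /CkS /IH IHg [dg Cg]; split=> [z Uz|w].
  apply: (@differentiable_comp _ _ _ _ g); first exact: dg.
  by apply/derivable1_diffP; have := dsqrt z Uz.
apply: (Ck_ext (g := fun z => 'D_w g z * (2 * Num.sqrt (g z))^-1)).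
  move=> z Uz; have ds : differentiable (@Num.sqrt R) (g z).
    by apply/derivable1_diffP; have := dsqrt z Uz.
  by rewrite (derive_comp1 _ (dg z Uz) ds) derive_sqrt ?g0.
apply: CkM; first exact: Cg.
apply: CkV => [z Uz|]; first by rewrite mulf_neq0 ?gt_eqF ?sqrtr_gt0 ?g0.
by apply: CkM => //; exact: Ck_cst.
Qed.

Lemma derive_coord m n (g : W -> 'M[R]_(m, n)) i j (z w : W) :
  differentiable g z -> 'D_w (fun z => g z i j) z = ('D_w g z) i j.
Proof. by move=> dg; rewrite derive_mx ?mxE//; exact: diff_derivable. Qed.

Lemma Ck_coord m n k (g : W -> 'M[R]_(m, n)) i j :
  Ck k U g -> Ck k U (fun z => g z i j).
Proof.
elim: k g => [|k IH] g.
  move=> cg z Uz; apply: (@continuous_comp _ _ _ g (fun M => M i j)).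
    exact: cg.
  exact: coord_continuous.
move=> [dg Cg]; split=> [z Uz|w].
  apply: (@differentiable_comp _ _ _ _ g (fun M => M i j)); first exact: dg.
  exact: differentiable_coord.
apply: (Ck_ext _ (IH _ (Cg w))) => z Uz.
by rewrite derive_coord//; exact: dg.
Qed.

Lemma Ck_sum (V : normedModType R) k n (g : 'I_n -> W -> V) :
  (forall i, Ck k U (g i)) -> Ck k U (fun z => \sum_i g i z).
Proof.
elim: n g => [|n IH] g Cg.
  by apply: (Ck_ext _ (Ck_cst k 0)) => z _; rewrite big_ord0.
apply: (Ck_ext _ (CkD (IH (fun i => g (widen_ord (leqnSn n) i)) _) (Cg ord_max))).
  by move=> z _; rewrite big_ord_recr.
by move=> i; exact: Cg.
Qed.

Lemma differentiable_row n (g : W -> 'rV[R]_n) (z : W) :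
  (forall i, differentiable (fun z => g z 0 i) z) -> differentiable g z.
Proof.
move=> dg; have -> : g = \sum_i (fun z => g z 0 i *: delta_mx 0 i : 'rV[R]_n).
  by apply/funext => y; rewrite {1}(row_sum_delta (g y)) fct_sumE.
by apply: differentiable_sum => i; exact: differentiableZl.
Qed.

(** Reduces smoothness of vector-valued maps to scalar ones, for which products are available. *)
Lemma Ck_row n k (g : W -> 'rV[R]_n) :
  (forall i, Ck k U (fun z => g z 0 i)) -> Ck k U g.
Proof.
elim: k g => [|k IH] g Cg.
  apply: (Ck_ext (g := fun z => \sum_i (g z 0 i *: delta_mx 0 i : 'rV[R]_n))).
    by move=> z _; rewrite -row_sum_delta.
  by apply: Ck_sum => i z Uz; apply: cvgZr_tmp; exact: Cg.
have dg z : U z -> differentiable g z.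
  by move=> Uz; apply: differentiable_row => i; have [/(_ z Uz)] := Cg i.
split=> // w; apply: IH => i; have [_ /(_ w)] := Cg i.
by apply: Ck_ext => z Uz; rewrite derive_coord//; exact: dg.
Qed.

Lemma smooth_row n (g : W -> 'rV[R]_n) :
  smooth_on U g <-> forall i, smooth_on U (fun z => g z 0 i).
Proof.
split=> [Cg i k|Cg k]; first exact/Ck_coord/Cg.
by apply: Ck_row => i; exact: Cg.
Qed.

End Ck_basics.

Lemma derive_comp (W V : normedModType R) n (x : W -> 'rV[R]_n) (f : 'rV[R]_n -> V)
  (z w : W) : differentiable x z -> differentiable f (x z) ->
  'D_w (f \o x) z = \sum_i ('D_w x z) 0 i *: 'D_(delta_mx 0 i) f (x z).
Proof.
move=> dx df; rewrite !deriveE//; last exact: differentiable_comp.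
rewrite diff_comp//= {1}(row_sum_delta ('d x z w)) linear_sum.
by apply: eq_bigr => i _; rewrite linearZ deriveE.
Qed.

(** By the chain rule the derivative is a sum of coordinates of ['D_w x] times partial derivatives
    of [f] composed with [x]; the induction is on [f], with [x] fixed. *)
Lemma Ck_comp (W : normedModType R) (U : set W) n m (V : set 'rV[R]_n)
    (x : W -> 'rV[R]_n) (f : 'rV[R]_n -> 'rV[R]_m) k :
  open U -> (forall z, U z -> V (x z)) -> Ck k U x -> Ck k V f ->
  Ck k U (f \o x).
Proof.
move=> oU UV; elim: k f => [|k IH] f.
  move=> Cx Cf z Uz; apply: continuous_comp; first exact: Cx.
  exact/Cf/UV.
move=> /[dup] /CkS Cx' [dx Cx] [df Cf]; split=> [z Uz|w].
  by apply: differentiable_comp; [exact: dx|exact/df/UV].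
apply: (@Ck_ext _ _ oU _ _ (fun z =>
    \sum_i ('D_w x z) 0 i *: ('D_(delta_mx 0 i) f \o x) z)).
  by move=> z Uz; rewrite derive_comp//; [exact: dx|exact/df/UV].
apply: Ck_sum => // i; apply: Ck_row => // j.
apply: (@Ck_ext _ _ oU _ _ (fun z =>
    ('D_w x z) 0 i * ('D_(delta_mx 0 i) f \o x) z 0 j)).
  by move=> z Uz; rewrite mxE.
apply: CkM => //; apply: Ck_coord => //; first exact: Cx.
by apply: IH => //; exact: Cf.
Qed.

End SmoothCalculus.

(** * Symmetry of second derivatives *)

Section Schwarz.
Context {R : realType}.

(** Equality of the difference quotients themselves, so that both the existence and the value of the
    derivative carry over to the restriction to a line. *)
Lemma derive_line_eq (W V : normedModType R) (g : W -> V) (y a : W) (s : R) :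
  (fun h : R => h^-1 *: (((fun t => g (y + t *: a)) \o shift s) (h *: 1) -
     g (y + s *: a)))
  = fun h => h^-1 *: ((g \o shift (y + s *: a)) (h *: a) - g (y + s *: a)).
Proof.
apply/funext => h /=; congr (_ *: (g _ - _)).
by rewrite -[h *: 1]/(h * 1) mulr1 scalerDl addrCA.
Qed.

Lemma derive_line (W V : normedModType R) (g : W -> V) (y a : W) (s : R) :
  'D_1 (fun t : R => g (y + t *: a)) s = 'D_a g (y + s *: a).
Proof. by rewrite /derive derive_line_eq. Qed.

Lemma derivable_line (W V : normedModType R) (g : W -> V) (y a : W) (s : R) :
  derivable g (y + s *: a) a -> derivable (fun t : R => g (y + t *: a)) s 1.
Proof. by rewrite /derivable derive_line_eq. Qed.

Lemma MVT_origin (l dl : R -> R) (h : R) : 0 < h ->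
  (forall s, 0 <= s <= h -> is_derive s 1 l (dl s)) ->
  exists2 s, 0 <= s <= h & l h - l 0 = h * dl s.
Proof.
move=> h0 ldl; have {}ldl s : s \in `[0, h] -> is_derive s 1 l (dl s).
  by rewrite in_itv; exact: ldl.
have cl : {within `[0, h], continuous l}.
  by apply: derivable_within_continuous => s /ldl ds; exact: ex_derive.
have ldl' s : s \in `]0, h[ -> is_derive s 1 l (dl s).
  by move=> /subset_itv_oo_cc; exact: ldl.
have [s] := MVT h0 ldl' cl.
by move=> /subset_itv_oo_cc; rewrite in_itv/= subr0 mulrC; exists s.
Qed.

Context {W : normedModType R}.
Implicit Types (g : W -> R) (U : set W).

Lemma mean_value_line g (y a : W) (h : R) : 0 < h ->
  (forall s, 0 <= s <= h -> differentiable g (y + s *: a)) ->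
  exists2 s, 0 <= s <= h & g (y + h *: a) - g y = h * 'D_a g (y + s *: a).
Proof.
move=> h0 dg.
have [|s sh E] := @MVT_origin (fun t => g (y + t *: a))
  (fun s => 'D_a g (y + s *: a)) h h0; last by exists s; rewrite // -E scale0r addr0.
move=> s sh; apply: DeriveDef; last exact: derive_line.
by apply/derivable_line/diff_derivable/dg.
Qed.

(** Mean value theorem twice: along [a] for the increment [g (y + h *: b) - g y], then along [b] for
    ['D_a g]. The left-hand side is symmetric in [a] and [b]. *)
Lemma second_difference U g (z a b : W) (h : R) : open U -> Ck 2 U g -> 0 < h ->
  (forall s t, 0 <= s <= h -> 0 <= t <= h -> U (z + s *: a + t *: b)) ->
  exists s t, [/\ 0 <= s <= h, 0 <= t <= h &
    g (z + h *: a + h *: b) - g (z + h *: a) - g (z + h *: b) + g z =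
    h ^+ 2 * 'D_b (fun y => 'D_a g y) (z + s *: a + t *: b)].
Proof.
move=> oU [dg Cg] h0 hU; have [dDg _] := Cg a.
have h00 : 0 <= (0 : R) <= h by rewrite lexx ltW.
have hh : 0 <= h <= h by rewrite lexx ltW.
have hU0 s : 0 <= s <= h -> U (z + s *: a).
  by move=> sh; have := hU s 0 sh h00; rewrite scale0r addr0.
have dgb y : U (y + h *: b) -> differentiable (fun y => g (y + h *: b)) y.
  move=> Uy; apply: (@differentiable_comp _ _ _ _ (fun y => y + h *: b)).
    by apply: differentiableD.
  exact: dg.
have Db y : 'D_a (fun y => g (y + h *: b)) y = 'D_a g (y + h *: b).
  by rewrite /derive /=; under eq_fun do rewrite -addrA.
have [|s sh Es] := @mean_value_line (fun y => g (y + h *: b) - g y) z a h h0.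
  move=> s sh; apply: differentiableB; [exact/dgb/hU|exact/dg/hU0].
have [|t th Et] := @mean_value_line (fun y => 'D_a g y) (z + s *: a) b h h0.
  by move=> t th; exact/dDg/hU.
exists s, t; split => //; rewrite expr2 -mulrA -Et.
rewrite -Db -deriveB -1?Es; first by rewrite opprB addrA addrAC.
- by apply/diff_derivable/dgb/hU.
- by apply/diff_derivable/dg/hU0.
Qed.

(** Supplies the parallelogram for second differences. With [a = b = ev] it also produces points off
    the axis arbitrarily close to a given one. *)
Lemma nbhs_parallelogram U (z a b : W) : nbhs z U -> exists2 d : R, 0 < d &
  forall s t, 0 <= s <= d -> 0 <= t <= d -> U (z + s *: a + t *: b).
Proof.
move=> /nbhs_ballP[e /= e0 eU]; pose M := `|a| + `|b| + 1.
(* The summand 1 keeps [M] positive when [a] and [b] both vanish. *)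
have M0 : 0 < M by rewrite ltr_wpDl// addr_ge0.
have [d d0 eE] : exists2 d, 0 < d & e = d * M * 2.
  by exists (e / M / 2); [rewrite !divr_gt0|rewrite mulrAC !divfK// gt_eqF].
exists d => // s t /andP[s0 sd] /andP[t0 td]; apply: eU.
rewrite -ball_normE /= -addrA opprD addNKr normrN.
rewrite (le_lt_trans (ler_normD _ _))// !normrZ !ger0_norm// eE.
rewrite (@le_lt_trans _ _ (d * (`|a| + `|b|)))//.
  by rewrite mulrDr lerD// ler_wpM2r.
rewrite -mulrA ltr_pM2l// /M.
have := normr_ge0 a; have := normr_ge0 b; lra.
Qed.

Lemma dist_le_split (e p q r : R) :
  `|p - r| < e / 2 -> `|q - r| < e / 2 -> `|p - q| <= e.
Proof. by rewrite !ltr_norml ler_norml; lra. Qed.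

(* By [second_difference] applied in both orders, the two mixed derivatives take
   a common value arbitrarily close to [z]. *)
Lemma derive_swap U g (z a b : W) : open U -> Ck 2 U g -> U z ->
  'D_a (fun y => 'D_b g y) z = 'D_b (fun y => 'D_a g y) z.
Proof.
move=> oU Cg Uz; have [_ CDg] := Cg.
have cD c d : {for z, continuous (fun y => 'D_c (fun y => 'D_d g y) y)}.
  by have [_ /(_ c)] := CDg d; exact.
apply/eqP; rewrite -subr_eq0 -normr_le0; apply/ler_addgt0Pl => e e0.
rewrite addr0.
have e2 : 0 < e / 2 by rewrite divr_gt0.
have /cvgrPdist_lt/(_ _ e2) n1 := cD a b.
have /cvgrPdist_lt/(_ _ e2) n2 := cD b a.
have nU : nbhs z U by exact: open_nbhs_nbhs.
have [d d0 dU] := nbhs_parallelogram a b (filterI nU (filterI n1 n2)).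
have [|s [t [sd td E1]]] := @second_difference U g z a b d oU Cg d0.
  by move=> s t sd td; have [] := dU s t sd td.
have [|t' [s' [td' sd' E2]]] := @second_difference U g z b a d oU Cg d0.
  move=> t' s' td' sd'; rewrite addrAC; by have [] := dU s' t' sd' td'.
have [_ [_ /= l2]] := dU s t sd td.
have [_ [/= l1 _]] := dU s' t' sd' td'.
have d20 : d ^+ 2 != 0 by rewrite expf_neq0// gt_eqF.
have E : 'D_b (fun y => 'D_a g y) (z + s *: a + t *: b) =
         'D_a (fun y => 'D_b g y) (z + s' *: a + t' *: b).
  move: E2; rewrite (addrAC z (t' *: b)) (addrAC z (d *: b)) => E2.
  apply: (mulfI d20); rewrite -[LHS]E1 -[RHS]E2; congr (_ + _); exact: addrAC.
by rewrite E in l2; exact: dist_le_split l1 l2.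
Qed.

End Schwarz.

(** * Scalar products and determinants in three-space *)

Section VectorAlgebra.
Context {R : realType}.
Implicit Types a b c n w : 'rV[R]_3.

Lemma dotE a b :
  dot a b = a 0 0 * b 0 0 + a 0 1 * b 0 1 + a 0 ord_max * b 0 ord_max.
Proof.
rewrite /dot !big_ord_recl big_ord0 addr0 addrA.
by do !congr (_ + _); congr (a _ _ * b _ _); apply: val_inj.
Qed.

Lemma dotC a b : dot a b = dot b a.
Proof. by rewrite !dotE; ring. Qed.

Lemma dotDl a b c : dot (a + b) c = dot a c + dot b c.
Proof. by rewrite !dotE !mxE; ring. Qed.

Lemma dotZl k a b : dot (k *: a) b = k * dot a b.
Proof. by rewrite !dotE !mxE; ring. Qed.

Lemma dotBl a b c : dot (a - b) c = dot a c - dot b c.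
Proof. by rewrite !dotE !mxE; ring. Qed.

Lemma dot0l a : dot 0 a = 0.
Proof. by rewrite dotE !mxE; ring. Qed.

Lemma dot_ge0 a : 0 <= dot a a.
Proof. by apply: sumr_ge0 => i _; rewrite -expr2 sqr_ge0. Qed.

Lemma enorm_sqr a : enorm a ^+ 2 = dot a a.
Proof. by rewrite sqr_sqrtr// dot_ge0. Qed.

(** A non-zero product with any vector rules out [a = 0]. Applied to a cross product, it turns a
    non-zero determinant into a positive length. *)
Lemma dot_gt0 a b : dot a b != 0 -> 0 < dot a a.
Proof.
move=> ab0; rewrite lt_neqAle dot_ge0 andbT eq_sym.
apply: contra ab0; rewrite psumr_eq0 => [/allP a0|i _]; last first.
  by rewrite -expr2 sqr_ge0.
apply/eqP; rewrite /dot big1// => i _; have := a0 i (mem_index_enum _).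
by rewrite /= -expr2 sqrf_eq0 => /eqP ->; rewrite mul0r.
Qed.

Lemma det3E a b c : det3 a b c =
    a 0 0 * (b 0 1 * c 0 ord_max - b 0 ord_max * c 0 1)
  - a 0 1 * (b 0 0 * c 0 ord_max - b 0 ord_max * c 0 0)
  + a 0 ord_max * (b 0 0 * c 0 1 - b 0 1 * c 0 0).
Proof.
rewrite /det3 (expand_det_row _ ord0) !big_ord_recl big_ord0 /cofactor.
rewrite !(expand_det_row _ ord0) !big_ord_recl !big_ord0 /cofactor !det_mx11.
rewrite !mxE /=.
(* The cofactor expansions leave iterated [lift]s as indices; each is identified with 0, 1 or
   [ord_max]. *)
have -> : lift ord0 ord0 = 1 :> 'I_3 by apply: val_inj.
have -> : lift ord0 (lift ord0 ord0) = ord_max :> 'I_3 by apply: val_inj.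
have -> : lift 1 ord0 = 0 :> 'I_3 by apply: val_inj.
have -> : lift 1 (lift ord0 ord0) = ord_max :> 'I_3 by apply: val_inj.
have -> : lift ord_max ord0 = 0 :> 'I_3 by apply: val_inj.
have -> : lift ord_max (lift ord0 ord0) = 1 :> 'I_3 by apply: val_inj.
have -> : lift ord0 (lift (lift ord0 ord0) 0) = 1 :> 'I_3 by apply: val_inj.
have -> : lift 1 (lift (lift ord0 ord0) 0) = 0 :> 'I_3 by apply: val_inj.
have -> : lift ord_max (lift (lift ord0 ord0) 0) = 0 :> 'I_3 by apply: val_inj.
have -> : ord0 = 0 :> 'I_3 by apply: val_inj.
by rewrite /bump /= !expr0 !expr1; ring.
Qed.

Lemma det3Zm k a b c : det3 a (k *: b) c = k * det3 a b c.
Proof. by rewrite !det3E !mxE; ring. Qed.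

Lemma det3Zr k a b c : det3 a b (k *: c) = k * det3 a b c.
Proof. by rewrite !det3E !mxE; ring. Qed.

(** The product is the determinant of the matrix of scalar products of [a, b, n] with [a, b, w]. In
    the expansion along the row of [n], orthogonality leaves only the term in [dot n w]. *)
Lemma det3_mul_gram a b n w : dot a n = 0 -> dot b n = 0 -> dot n n = 1 ->
  det3 a b n * det3 a b w = (dot a a * dot b b - dot a b ^+ 2) * dot n w.
Proof.
move=> an bn nn.
have -> : det3 a b n * det3 a b w =
    (dot a a * dot b b - dot a b ^+ 2) * dot n w
    - dot a n * (dot b b * dot a w - dot a b * dot b w)
    + dot b n * (dot a b * dot a w - dot a a * dot b w).
  by rewrite !det3E !dotE; ring.
by rewrite an bn; ring.
Qed.

Lemma gram_eq_det3 a b n : dot a n = 0 -> dot b n = 0 -> dot n n = 1 ->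
  dot a a * dot b b - dot a b ^+ 2 = det3 a b n ^+ 2.
Proof.
by move=> an bn nn; rewrite [RHS]expr2 (det3_mul_gram n an bn nn) nn mulr1.
Qed.

Lemma det3_neq0 a b c : row_free (rows3 a b c) -> det3 a b c != 0.
Proof. by rewrite row_free_unit unitmxE unitfE. Qed.

Lemma dot_cross a b c : dot (cross a b) c = det3 a b c.
Proof. by rewrite !dotE !det3E !mxE !det3E !mxE /=; ring. Qed.

(** Cramer's rule: the determinant times a coordinate of [w] is a combination of the three scalar
    products, with cofactors as coefficients. *)
Lemma orthogonal_eq0 a b c w : det3 a b c != 0 ->
  dot w a = 0 -> dot w b = 0 -> dot w c = 0 -> w = 0.
Proof.
move=> abc wa wb wc.
have E0 : det3 a b c * w 0 0 = 0.
  have -> : det3 a b c * w 0 0 =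
      dot w a * (b 0 1 * c 0 ord_max - b 0 ord_max * c 0 1)
    + dot w b * (c 0 1 * a 0 ord_max - c 0 ord_max * a 0 1)
    + dot w c * (a 0 1 * b 0 ord_max - a 0 ord_max * b 0 1).
    by rewrite !det3E !dotE; ring.
  by rewrite wa wb wc; ring.
have E1 : det3 a b c * w 0 1 = 0.
  have -> : det3 a b c * w 0 1 =
      dot w a * (b 0 ord_max * c 0 0 - b 0 0 * c 0 ord_max)
    + dot w b * (c 0 ord_max * a 0 0 - c 0 0 * a 0 ord_max)
    + dot w c * (a 0 ord_max * b 0 0 - a 0 0 * b 0 ord_max).
    by rewrite !det3E !dotE; ring.
  by rewrite wa wb wc; ring.
have E2 : det3 a b c * w 0 ord_max = 0.
  have -> : det3 a b c * w 0 ord_max =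
      dot w a * (b 0 0 * c 0 1 - b 0 1 * c 0 0)
    + dot w b * (c 0 0 * a 0 1 - c 0 1 * a 0 0)
    + dot w c * (a 0 0 * b 0 1 - a 0 1 * b 0 0).
    by rewrite !det3E !dotE; ring.
  by rewrite wa wb wc; ring.
apply/rowP => i; rewrite mxE; apply: (mulfI abc); rewrite mulr0.
have [->|[->|->]] // : i = 0 \/ i = 1 \/ i = ord_max.
by case: i => -[|[|[|//]]] ?; [left|right; left|right; right]; exact: val_inj.
Qed.

End VectorAlgebra.

(** * Closure properties of smooth maps *)

Section SmoothOn.
Context {R : realType} {W : normedModType R} {U : set W} (oU : open U).
Implicit Types (V : normedModType R).

Lemma smooth_subset V (U' : set W) (g : W -> V) :
  U' `<=` U -> smooth_on U g -> smooth_on U' g.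
Proof.
move=> UU Cg k; have {Cg} := Cg k; elim: k g => [|k IH] g /=.
  by move=> cg z /UU; exact: cg.
by case=> dg Cg; split=> [z /UU|w]; [exact: dg|exact/IH/Cg].
Qed.

Lemma smooth_ext V (g h : W -> V) :
  (forall z, U z -> g z = h z) -> smooth_on U g -> smooth_on U h.
Proof. by move=> gh Cg k; apply: Ck_ext gh (Cg k). Qed.

Lemma smooth_derive V (g : W -> V) w : smooth_on U g ->
  smooth_on U (fun z => 'D_w g z).
Proof. by move=> Cg k; have [_] := Cg k.+1; exact. Qed.

Lemma smooth_differentiable V (g : W -> V) z :
  smooth_on U g -> U z -> differentiable g z.
Proof. by move=> Cg; have [+ _] := Cg 1; exact. Qed.

Lemma smooth_continuous V (g : W -> V) z :
  smooth_on U g -> U z -> {for z, continuous g}.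
Proof. by move=> Cg; exact: (Cg 0). Qed.

Lemma smooth_cst V (c : V) : smooth_on U (fun=> c).
Proof. by move=> k; exact: Ck_cst. Qed.

Lemma smoothD V (g h : W -> V) :
  smooth_on U g -> smooth_on U h -> smooth_on U (fun z => g z + h z).
Proof. by move=> Cg Ch k; exact: CkD. Qed.

Lemma smoothN V (g : W -> V) :
  smooth_on U g -> smooth_on U (fun z => - g z).
Proof. by move=> Cg k; exact: CkN. Qed.

Lemma smoothB V (g h : W -> V) :
  smooth_on U g -> smooth_on U h -> smooth_on U (fun z => g z - h z).
Proof. by move=> Cg Ch k; exact: CkB. Qed.

Lemma smoothM (g h : W -> R) :
  smooth_on U g -> smooth_on U h -> smooth_on U (fun z => g z * h z).
Proof. by move=> Cg Ch k; exact: CkM. Qed.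

Lemma smoothX n (g : W -> R) :
  smooth_on U g -> smooth_on U (fun z => g z ^+ n).
Proof. by move=> Cg k; exact: CkX. Qed.

Lemma smoothV (g : W -> R) : (forall z, U z -> g z != 0) ->
  smooth_on U g -> smooth_on U (fun z => (g z)^-1).
Proof. by move=> g0 Cg k; exact: CkV. Qed.

Lemma smooth_sqrt (g : W -> R) : (forall z, U z -> 0 < g z) ->
  smooth_on U g -> smooth_on U (fun z => Num.sqrt (g z)).
Proof. by move=> g0 Cg k; exact: Ck_sqrt. Qed.

Lemma smooth_coord m n (g : W -> 'M[R]_(m, n)) i j :
  smooth_on U g -> smooth_on U (fun z => g z i j).
Proof. by move=> Cg k; exact: Ck_coord. Qed.

Lemma smooth_sum V n (g : 'I_n -> W -> V) :
  (forall i, smooth_on U (g i)) -> smooth_on U (fun z => \sum_i g i z).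
Proof. by move=> Cg k; apply: Ck_sum => // i; exact: Cg. Qed.

Lemma smooth_id : smooth_on U (fun z => z).
Proof.
case=> [|k] /=; first by move=> z _; exact: cvg_id.
split=> // w; apply: Ck_ext (Ck_cst oU k w) => // z _.
by rewrite derive_id.
Qed.

Lemma smoothZ n (a : W -> R) (b : W -> 'rV[R]_n) :
  smooth_on U a -> smooth_on U b -> smooth_on U (fun z => a z *: b z).
Proof.
move=> Ca Cb; apply/smooth_row => // i.
apply: (@smooth_ext _ (fun z => a z * b z 0 i)); first by move=> z _; rewrite mxE.
by apply: smoothM => //; exact: smooth_coord.
Qed.

Lemma smooth_dot (a b : W -> 'rV[R]_3) :
  smooth_on U a -> smooth_on U b -> smooth_on U (fun z => dot (a z) (b z)).
Proof.
by move=> Ca Cb; apply: smooth_sum => i; apply: smoothM; exact: smooth_coord.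
Qed.

Lemma smooth_det3 (a b c : W -> 'rV[R]_3) :
  smooth_on U a -> smooth_on U b -> smooth_on U c ->
  smooth_on U (fun z => det3 (a z) (b z) (c z)).
Proof.
move=> Ca Cb Cc; pose E z :=
    a z 0 0 * (b z 0 1 * c z 0 ord_max - b z 0 ord_max * c z 0 1)
  - a z 0 1 * (b z 0 0 * c z 0 ord_max - b z 0 ord_max * c z 0 0)
  + a z 0 ord_max * (b z 0 0 * c z 0 1 - b z 0 1 * c z 0 0).
apply: (@smooth_ext _ E); first by move=> z _; rewrite det3E.
have {}Ca i := smooth_coord 0 i Ca.
have {}Cb i := smooth_coord 0 i Cb.
have {}Cc i := smooth_coord 0 i Cc.
by rewrite /E; repeat first [exact: Ca | exact: Cb | exact: Cc |
  apply: smoothB | apply: smoothD | apply: smoothM].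
Qed.

End SmoothOn.

(** * Product rules and symmetry of mixed derivatives for vector-valued maps *)

Section DeriveRules.
Context {R : realType} {W : normedModType R}.

Lemma derive_mul (a b : W -> R) (z w : W) :
  differentiable a z -> differentiable b z ->
  'D_w (fun z => a z * b z) z = 'D_w a z * b z + a z * 'D_w b z.
Proof.
move=> da db; rewrite -[LHS]/('D_w (a * b) z) deriveM; [|exact: diff_derivable..].
by rewrite addrC mulrC.
Qed.

Lemma differentiable_entry n (b : W -> 'rV[R]_n) i (z : W) :
  differentiable b z -> differentiable (fun z => b z 0 i) z.
Proof.
move=> db; apply: (@differentiable_comp _ _ _ _ b (fun M => M 0 i)) => //.
exact: differentiable_coord.
Qed.

Lemma derive_dot (a b : W -> 'rV[R]_3) (z w : W) :
  differentiable a z -> differentiable b z ->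
  'D_w (fun z => dot (a z) (b z)) z = dot ('D_w a z) (b z) + dot (a z) ('D_w b z).
Proof.
move=> da db; have dc := differentiable_entry.
rewrite /dot -big_split /=.
have -> : (fun z => \sum_(i < 3) a z 0 i * b z 0 i) =
    \sum_(i < 3) (fun z => a z 0 i * b z 0 i).
  by apply/funext => y; rewrite fct_sumE.
rewrite derive_sum => [|i]; last first.
  by apply: diff_derivable; apply: differentiableM; exact: dc.
by apply: eq_bigr => i _; rewrite derive_mul ?derive_coord//; exact: dc.
Qed.

Lemma differentiable_scale n (a : W -> R) (b : W -> 'rV[R]_n) (z : W) :
  differentiable a z -> differentiable b z ->
  differentiable (fun z => a z *: b z) z.
Proof.
move=> da db; apply: differentiable_row => i.
have -> : (fun z => (a z *: b z) 0 i) = a * (fun z => b z 0 i).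
  by apply/funext => y; rewrite mxE.
by apply: differentiableM => //; exact: differentiable_entry.
Qed.

Lemma derive_scale n (a : W -> R) (b : W -> 'rV[R]_n) (z w : W) :
  differentiable a z -> differentiable b z ->
  'D_w (fun z => a z *: b z) z = 'D_w a z *: b z + a z *: 'D_w b z.
Proof.
move=> da db; apply/rowP => i.
rewrite -derive_coord; last exact: differentiable_scale.
have -> : (fun z => (a z *: b z) 0 i) = (fun z => a z * b z 0 i).
  by apply/funext => y; rewrite mxE.
by rewrite derive_mul// ?derive_coord ?mxE//; exact: differentiable_entry.
Qed.

Lemma derive_swap_row n (U : set W) (g : W -> 'rV[R]_n) (z a b : W) :
  open U -> smooth_on U g -> U z ->
  'D_a (fun y => 'D_b g y) z = 'D_b (fun y => 'D_a g y) z.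
Proof.
move=> oU Cg Uz; apply/rowP => i.
have DD c d : ('D_c (fun y => 'D_d g y) z) 0 i =
    'D_c (fun y => 'D_d (fun y => g y 0 i) y) z.
  rewrite -derive_coord; last exact: smooth_differentiable (smooth_derive d Cg) Uz.
  apply: near_eqD; have nU : \forall y \near z, U y by exact: open_nbhs_nbhs.
  apply: filterS nU => y Uy; rewrite derive_coord//.
  exact: smooth_differentiable Cg Uy.
apply: etrans (DD a b) _; apply: etrans (esym (DD b a)).
by apply: (derive_swap _ _ oU) => //; exact: (smooth_coord oU _ _ Cg).
Qed.

End DeriveRules.

(** * Boundedness of the principal curvatures *)

Section Extensions.
Context {R : realType}.
Implicit Types (h k : 'rV[R]_2 -> R) (z : 'rV[R]_2).

Lemma vcoord_line z (t : R) : vcoord (z + t *: ev) = vcoord z + t.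
Proof. by rewrite /vcoord !mxE /= mulr1. Qed.

Lemma cvg_axis : (t *: eu : 'rV[R]_2) @[t --> (0 : R)^'] --> (0 : 'rV[R]_2).
Proof.
rewrite -(scale0r (eu : 'rV[R]_2)); apply: cvg_within_filter.
exact: scalel_continuous.
Qed.

Lemma nbhs_off_axis z (U : set 'rV[R]_2) : nbhs z U ->
  exists2 y, U y & vcoord y != 0.
Proof.
move=> nU; have [vz|vz] := eqVneq (vcoord z) 0; last first.
  by exists z => //; exact: nbhs_singleton.
have [d d0 dU] := nbhs_parallelogram ev ev nU.
exists (z + d *: ev + 0 *: ev).
  by apply: dU; rewrite ?lexx ltW.
by rewrite scale0r addr0 vcoord_line vz add0r gt_eqF.
Qed.

(** A non-zero value would persist nearby by continuity, hence at some point off the axis. This is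
    how relations obtained after division by [v] reach the axis. *)
Lemma eq0_off_axis h z : {for z, continuous h} ->
  (\forall y \near z, vcoord y != 0 -> h y = 0) -> h z = 0.
Proof.
move=> ch h0; apply/eqP; apply: contraT => hz0.
have hn0 : \forall y \near z, h y != 0 by exact: cvgr_neq0 ch hz0.
have [y [hy hy0] vy] := nbhs_off_axis (filterI h0 hn0).
by rewrite (hy vy) eqxx in hy0.
Qed.

Lemma smooth_extension_unique h k k' :
  smooth_extension h k -> smooth_extension h k' -> k 0 = k' 0.
Proof.
move=> [W [oW W0 Ck kh]] [W' [oW' W'0 Ck' kh']].
apply/eqP; rewrite -subr_eq0; apply/eqP.
apply: (@eq0_off_axis (fun z => k z - k' z)).
  exact: cvgB (smooth_continuous Ck W0) (smooth_continuous Ck' W'0).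
have nW : nbhs (0 : 'rV[R]_2) W by exact: open_nbhs_nbhs.
have nW' : nbhs (0 : 'rV[R]_2) W' by exact: open_nbhs_nbhs.
by apply: filterS2 nW nW' => y Wy W'y vy; rewrite kh// kh'// subrr.
Qed.

(** Makes the choice by [xget] harmless: any explicit extension computes the value. *)
Lemma value_at_originE h k : smooth_extension h k -> value_at_origin h = k 0.
Proof.
move=> hk; rewrite /value_at_origin; case: xgetP => [k' _|/(_ k)//].
by move=> hk'; exact: smooth_extension_unique hk' hk.
Qed.

Lemma bounded_smoothW h : bounded_smooth h -> bounded_at_origin h.
Proof.
move=> [k [W [oW W0 Ck kh]]]; exists (`|k 0| + 1).
have nW : nbhs (0 : 'rV[R]_2) W by exact: open_nbhs_nbhs.
have ck : {for 0, continuous k} by exact: smooth_continuous Ck W0.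
have kb : \forall z \near (0 : 'rV[R]_2), `|k z| < `|k 0| + 1.
  by apply: (cvgr_norm_lt (k 0) ck); rewrite ltrDl.
by apply: filterS2 nW kb => z Wz kz vz; rewrite -kh// ltW.
Qed.

Lemma unbounded_not_bounded h : unbounded_at_origin h -> ~ bounded_at_origin h.
Proof.
move=> uh [M hM]; have [z [/= hz vz Mz]] := uh _ hM M.
by have := hz vz; rewrite leNgt Mz.
Qed.

Lemma unbounded_quotient h (a : 'rV[R]_2 -> R) : {for 0, continuous a} ->
  a 0 != 0 -> (\forall z \near (0 : 'rV[R]_2), vcoord z != 0 -> h z = a z / vcoord z) ->
  unbounded_at_origin h.
Proof.
move=> ca a0 ha W nW M.
have a2 : `|a 0| / 2 < `|a 0| by rewrite ltr_pdivrMr// mulr_natr mulr2n ltrDl normr_gt0.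
have an : \forall z \near (0 : 'rV[R]_2), `|a 0| / 2 < `|a z|.
  exact: (cvgr_norm_gt (a 0) ca).
have [d d0 dW] := nbhs_parallelogram ev ev (filterI nW (filterI ha an)).
have M0 : 0 < `|M| + 1 by rewrite ltr_wpDl.
(* The bound [d] keeps the point inside the neighbourhood; the other one gives
   [(|M| + 1) t <= |a 0| / 2 < |a z|] at that point, so the quotient exceeds [M], whatever the sign
   of [M]. *)
pose t := Num.min d (`|a 0| / 2 / (`|M| + 1)).
have b0 : 0 < `|a 0| / 2 by rewrite divr_gt0// normr_gt0.
have t0 : 0 < t by rewrite lt_min d0/= divr_gt0.
have [||/= Wz [hz az]] := dW t 0.
- by rewrite (ltW t0)/= ge_min lexx.
- by rewrite lexx ltW.
move: Wz hz az; rewrite scale0r addr0 add0r => Wz hz az.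
have vz : vcoord (t *: ev) = t by rewrite -[_ *: _]add0r vcoord_line /vcoord mxE add0r.
exists (t *: ev); rewrite vz gt_eqF//; split => //.
rewrite hz vz ?gt_eqF// normrM normfV (gtr0_norm t0) ltr_pdivlMr//.
apply: le_lt_trans az; apply: (@le_trans _ _ ((`|M| + 1) * t)).
  by rewrite ler_pM2r// (le_trans (ler_norm M))// lerDl.
by rewrite mulrC -ler_pdivlMr// ge_min lexx orbT.
Qed.

End Extensions.

(** * Smoothness and blow-up of the two roots *)

Section PrincipalCurvatures.
Context {R : realType}.

(** Rationalization: [(A - B) (A + B) = 4 v D Q]. Hence the two branches in the definition of a
    principal curvature agree wherever both make sense off the axis. *)
Lemma kappa_fractions (A B D Q v : R) : B ^+ 2 = A ^+ 2 - 4 * v * D * Q ->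
  v != 0 -> D != 0 -> A + B != 0 -> 2 * Q / (A + B) = (A - B) / (2 * v * D).
Proof.
move=> B2 v0 D0 AB; apply/eqP; rewrite eqr_div ?mulf_neq0//; apply/eqP.
have -> : (A - B) * (A + B) = A ^+ 2 - B ^+ 2 by ring.
by rewrite B2; ring.
Qed.

Lemma Broot_sqr (v A D Q : R) : 0 <= A ^+ 2 - 4 * v * D * Q ->
  Broot v A D Q ^+ 2 = A ^+ 2 - 4 * v * D * Q.
Proof. exact: sqr_sqrtr. Qed.

Lemma kappa_plusE (v A D Q : R) :
  v != 0 -> D != 0 -> 0 <= A ^+ 2 - 4 * v * D * Q ->
  kappa_plus_of v A D Q = (A - Broot v A D Q) / (2 * v * D).
Proof.
move=> v0 D0 /Broot_sqr B2; rewrite /kappa_plus_of; case: ifP => // AB.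
exact: kappa_fractions.
Qed.

Lemma kappa_minusE (v A D Q : R) :
  v != 0 -> D != 0 -> 0 <= A ^+ 2 - 4 * v * D * Q ->
  kappa_minus_of v A D Q = (A + Broot v A D Q) / (2 * v * D).
Proof.
move=> v0 D0 /Broot_sqr B2; rewrite /kappa_minus_of; case: ifP => // AB.
(* The formula for [kappa_-] is the one for [kappa_+] with [- B] in place of [B]. *)
rewrite -{2}(opprK (Broot v A D Q)); apply: kappa_fractions => //.
by rewrite sqrrN.
Qed.

Context {U : set 'rV[R]_2} (oU : open U) (U0 : U 0).
Context {A D Q : 'rV[R]_2 -> R}.
Hypotheses (CA : smooth_on U A) (CD : smooth_on U D) (CQ : smooth_on U Q).
Hypothesis D0 : forall z, U z -> 0 < D z.

(** Discriminant of the quadratic equation [v D k^2 - A k + Q = 0] for the principal curvatures. *)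
Let rad z := A z ^+ 2 - 4 * vcoord z * D z * Q z.

Lemma smooth_discriminant : smooth_on U rad.
Proof.
apply: smoothB => //; first exact: smoothX.
apply: smoothM => //; apply: smoothM => //; apply: smoothM => //.
  exact: smooth_cst.
by apply: smooth_coord => //; exact: smooth_id.
Qed.

Lemma discriminant0 : rad 0 = A 0 ^+ 2.
Proof. by rewrite /rad /vcoord mxE !(mulr0, mul0r) subr0. Qed.

(** The discriminant at the origin is [A(0)^2]. Its positivity nearby makes the square root smooth
    and keeps it from taking the default value at negative arguments. *)
Lemma discriminant_near : A 0 != 0 ->
  \forall z \near (0 : 'rV[R]_2), U z /\ 0 < rad z.
Proof.
move=> A0; have nU : nbhs (0 : 'rV[R]_2) U by exact: open_nbhs_nbhs.
have cr : {for 0, continuous rad} by exact: smooth_continuous smooth_discriminant U0.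
have r0 : 0 < rad 0 by rewrite discriminant0 lt_neqAle eq_sym sqrf_eq0 A0 sqr_ge0.
exact: (filterI nU (cvgr_gt (rad 0) cr _ r0)).
Qed.

Let B z := Broot (vcoord z) (A z) (D z) (Q z).

Lemma Broot0 : B 0 = `|A 0|.
Proof. by rewrite /B /Broot -/(rad 0) discriminant0 sqrtr_sqr. Qed.

Lemma Broot_continuous : {for 0, continuous B}.
Proof.
apply: (@continuous_comp _ _ _ rad); last exact: sqrt_continuous.
exact: smooth_continuous smooth_discriminant U0.
Qed.

Lemma kappa_plus_extension : 0 < A 0 -> exists2 k,
  smooth_extension (fun z => kappa_plus_of (vcoord z) (A z) (D z) (Q z)) k &
  k 0 = Q 0 / A 0.
Proof.
move=> A0; exists (fun z => 2 * Q z / (A z + B z)); last first.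
  rewrite Broot0 gtr0_norm// -mulr2n -(mulr_natl (A 0)) -mulf_div.
  by rewrite divff ?mul1r// pnatr_eq0.
(* Positivity of the discriminant makes [B] smooth, and positivity of [A] makes [A + B] invertible,
   also on the axis; the interior is taken to have an open set. *)
pose W := [set z | (U z /\ 0 < rad z) /\ 0 < A z]°.
have WE z : W z -> (U z /\ 0 < rad z) /\ 0 < A z by move=> /interior_subset.
have Cs (V : normedModType R) (g : 'rV[R]_2 -> V) : smooth_on U g -> smooth_on W g.
  by apply: smooth_subset => z /WE[[]].
have AB z : W z -> A z + B z != 0.
  by move=> /WE[_ Az]; rewrite gt_eqF// ltr_wpDr// sqrtr_ge0.
exists W; split.
- exact: open_interior.
- have An : \forall z \near (0 : 'rV[R]_2), 0 < A z.
    exact: (cvgr_gt (A 0) (smooth_continuous CA U0)).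
  by apply: (filterI (discriminant_near _) An); rewrite gt_eqF.
- have oW : open W by exact: open_interior.
  apply: smoothM => //.
    by apply: smoothM => //; [exact: smooth_cst|exact: Cs].
  apply: smoothV => //; apply: smoothD => //; first exact: Cs.
  apply: smooth_sqrt => //; last exact: (Cs _ _ smooth_discriminant).
  by move=> z /WE[[_ ?]].
- by move=> z Wz vz; rewrite /kappa_plus_of AB.
Qed.

(** The factor [2 D], positive and continuous, is absorbed into the numerator, which leaves a
    quotient by [v] alone. *)
Lemma kappa_quotient_unbounded (h a : 'rV[R]_2 -> R) : {for 0, continuous a} ->
  a 0 != 0 ->
  (\forall z \near (0 : 'rV[R]_2), vcoord z != 0 -> h z = a z / (2 * vcoord z * D z)) ->
  unbounded_at_origin h.
Proof.
move=> ca a0 ha; apply: (@unbounded_quotient _ _ (fun z => a z / (2 * D z))).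
- have cD : {for 0, continuous (fun z => (2 * D z)^-1)}.
    have c2D : {for 0, continuous (fun z => 2 * D z)}.
      exact: cvgM (cvg_cst _) (smooth_continuous CD U0).
    by apply: (cvgV _ c2D); rewrite mulf_neq0// gt_eqF ?D0.
  exact: cvgM ca cD.
- by rewrite mulf_neq0// invr_neq0// mulf_neq0// gt_eqF ?D0.
- apply: filterS ha => z hz vz; rewrite hz// -!mulrA; congr (_ * _).
  by rewrite !invfM; ring.
Qed.

(** Since [B 0 = A 0] here, the numerator [A + B] has the non-zero value [2 A(0)] at the origin. For
    negative [A(0)] the numerator [A - B] of [kappa_+] has that value. *)
Lemma kappa_minus_unbounded : 0 < A 0 ->
  unbounded_at_origin (fun z => kappa_minus_of (vcoord z) (A z) (D z) (Q z)).
Proof.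
move=> A0; apply: (@kappa_quotient_unbounded _ (fun z => A z + B z)).
- exact: cvgD (smooth_continuous CA U0) Broot_continuous.
- by rewrite Broot0 gtr0_norm// gt_eqF// addr_gt0.
have := discriminant_near (lt0r_neq0 A0); apply: filterS => z [Uz rz] vz.
by rewrite kappa_minusE// ?ltW// gt_eqF ?D0.
Qed.

Lemma kappa_plus_unbounded : A 0 < 0 ->
  unbounded_at_origin (fun z => kappa_plus_of (vcoord z) (A z) (D z) (Q z)).
Proof.
move=> A0; apply: (@kappa_quotient_unbounded _ (fun z => A z - B z)).
- exact: cvgB (smooth_continuous CA U0) Broot_continuous.
- by rewrite Broot0 ltr0_norm// opprK lt_eqF// -mulr2n pmulrn_llt0.
have := discriminant_near (ltr0_neq0 A0); apply: filterS => z [Uz rz] vz.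
by rewrite kappa_plusE// ?ltW// gt_eqF ?D0.
Qed.

Lemma kappa_plus_bounded_smooth : A 0 != 0 ->
  bounded_smooth (fun z => kappa_plus_of (vcoord z) (A z) (D z) (Q z)) ->
  0 < A 0.
Proof.
rewrite neq_lt => /orP[A0 /bounded_smoothW|//].
by move=> /(unbounded_not_bounded (kappa_plus_unbounded A0)).
Qed.

(** The sign of [A(0)] determines one curvature that is certainly unbounded: this is the conclusion
    of one implication and contradicts the premise of the other. *)
Lemma kappa_unbounded : A 0 != 0 ->
  let kp z := kappa_plus_of (vcoord z) (A z) (D z) (Q z) in
  let km z := kappa_minus_of (vcoord z) (A z) (D z) (Q z) in
  (bounded_at_origin kp -> unbounded_at_origin km) /\
  (bounded_at_origin km -> unbounded_at_origin kp).
Proof.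
move=> + kp km; rewrite neq_lt => /orP[A0|A0].
  have up := kappa_plus_unbounded A0.
  by split => // /(unbounded_not_bounded up).
have um := kappa_minus_unbounded A0.
by split => // /(unbounded_not_bounded um).
Qed.

End PrincipalCurvatures.

(** * Fronts in adapted coordinates *)

Section MeanCurvatureAlgebra.
Context {R : realType}.

Lemma divff_cancel (a b c : R) : a != 0 -> a * b / (c * a) = b / c.
Proof. by move=> a0; rewrite (mulrC c) -mulf_div divff// mul1r. Qed.

(* With [g_u = v phi - e g_v], the primed letters are the coefficients of the
   ordinary fundamental forms in terms of the modified ones. *)
Lemma mean_curvature_identity (v e E F G L M N : R) : v != 0 ->
  E * G - F ^+ 2 != 0 ->
  let E' := v ^+ 2 * E - 2 * v * e * F + e ^+ 2 * G in
  let F' := v * F - e * G in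
  let L' := v * L - e * v * M + e ^+ 2 * N in
  let M' := v * M - e * N in
  v * ((E' * N - 2 * F' * M' + G * L') / (2 * (E' * G - F' ^+ 2))) =
  (G * (L + e * M) - 2 * v * F * M + v * E * N) / (2 * (E * G - F ^+ 2)).
Proof.
move=> v0; set D := E * G - F ^+ 2 => D0 E' F' L' M'.
have -> : E' * N - 2 * F' * M' + G * L' =
    v * (G * (L + e * M) - 2 * v * F * M + v * E * N).
  by rewrite /E' /F' /L' /M'; ring.
have -> : E' * G - F' ^+ 2 = v ^+ 2 * D by rewrite /E' /F' /D; ring.
by move: D D0 => D D0; field; rewrite v0 D0.
Qed.

(** To be read with [a = phi], [b = g_v], [p = n_u], [q = n_v], so that [w = g_u]; the first
    hypothesis is then the symmetry of the second fundamental form. *)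
Lemma mean_curvature_vectors (v e : R) (a b p q : 'rV[R]_3) :
  dot b p = dot (v *: a - e *: b) q -> v != 0 ->
  dot a a * dot b b - dot a b ^+ 2 != 0 ->
  let w := v *: a - e *: b in
  v * ((dot w w * - dot b q - 2 * dot w b * - dot w q + dot b b * - dot w p)
    / (2 * (dot w w * dot b b - dot w b ^+ 2))) =
  (dot b b * (- dot a p + e * - dot a q) - 2 * v * dot a b * - dot a q
    + v * dot a a * - dot b q) / (2 * (dot a a * dot b b - dot a b ^+ 2)).
Proof.
move=> bp v0 D0 w.
rewrite -(@mean_curvature_identity v e (dot a a) (dot a b) (dot b b))//.
have dotw c : dot w c = v * dot a c - e * dot b c by rewrite dotBl !dotZl.
have ww : dot w w = v ^+ 2 * dot a a - 2 * v * e * dot a b + e ^+ 2 * dot b b.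
  rewrite dotw ![dot _ w]dotC !dotw (dotC b a).
  by move: (dot a a) (dot a b) (dot b b) => x y z; ring.
have wp : - dot w p = v * - dot a p - e * v * - dot a q + e ^+ 2 * - dot b q.
  rewrite dotw bp -/w dotw.
  by move: (dot a p) (dot a q) (dot b q) => x y z; ring.
have wq : - dot w q = v * - dot a q - e * - dot b q.
  by rewrite dotw; move: (dot a q) (dot b q) => x y; ring.
by rewrite wp wq ww dotw.
Qed.

End MeanCurvatureAlgebra.

(** * Relations between a map and its unit normal in coordinates *)

Section LocalFront.
Context {R : realType} {U : set 'rV[R]_2} (oU : open U) (U0 : U 0).
Context {g n : 'rV[R]_2 -> 'rV[R]_3}.
Hypotheses (Cg : smooth_on U g) (Cn : smooth_on U n).
Hypothesis unit_n : forall z, U z -> dot (n z) (n z) = 1.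
Hypothesis orth_n : forall z w, U z -> dot ('D_w g z) (n z) = 0.

Lemma derive_near0 (V : normedModType R) (h : 'rV[R]_2 -> V) z w : U z ->
  (forall y, U y -> h y = 0) -> 'D_w h z = 0.
Proof.
move=> Uz h0; rewrite (near_eqD (g := cst 0)) ?derive_cst//.
by have : nbhs z U by [exact: open_nbhs_nbhs]; apply: filterS => y /h0.
Qed.

Lemma near_eqD_on (V : normedModType R) (h k : 'rV[R]_2 -> V) z w : U z ->
  (forall y, U y -> h y = k y) -> 'D_w h z = 'D_w k z.
Proof.
move=> Uz hk; apply: near_eqD.
by have : nbhs z U by [exact: open_nbhs_nbhs]; apply: filterS => y /hk.
Qed.

(** Derivative of the relation [dot a n = 0]. It trades derivatives of tangent fields for
    derivatives of the normal. *)
Lemma tangent_derive (a : 'rV[R]_2 -> 'rV[R]_3) z w : smooth_on U a ->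
  (forall y, U y -> dot (a y) (n y) = 0) -> U z ->
  dot ('D_w a z) (n z) = - dot (a z) ('D_w n z).
Proof.
move=> Ca an Uz; apply/eqP; rewrite -addr_eq0 -derive_dot.
- by apply/eqP; exact: derive_near0.
- exact: smooth_differentiable Ca Uz.
- exact: smooth_differentiable Cn Uz.
Qed.

Lemma normal_derive z w : U z -> dot ('D_w n z) (n z) = 0.
Proof.
move=> Uz; have dn := smooth_differentiable Cn Uz.
have E : 'D_w (fun z => dot (n z) (n z)) z = 0.
  by have := @near_eqD_on R _ (fun=> 1) z w Uz unit_n; rewrite derive_cst.
have := derive_dot w dn dn; rewrite E (dotC (n z)) -mulr2n => /esym/eqP.
by rewrite mulrn_eq0 => /eqP.
Qed.

(** Both sides are the negative of the normal component of a mixed second derivative of [g], and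
    mixed derivatives commute. *)
Lemma second_form_sym z a b : U z ->
  dot ('D_a g z) ('D_b n z) = dot ('D_b g z) ('D_a n z).
Proof.
move=> Uz; apply: oppr_inj; have Cd c : smooth_on U (fun y => 'D_c g y).
  exact: smooth_derive.
have E c d := @tangent_derive (fun y => 'D_c g y) z d (Cd c)
  (fun y Uy => orth_n c Uy) Uz.
apply: etrans (esym (E a b)) (etrans _ (E b a)).
exact: (congr1 (fun v => dot v (n z)) (derive_swap_row b a oU Cg Uz)).
Qed.

Lemma differentiable_vcoord (z : 'rV[R]_2) : differentiable (@vcoord R) z.
Proof. exact: differentiable_coord. Qed.

Lemma derive_vcoord (z w : 'rV[R]_2) : 'D_w (@vcoord R) z = vcoord w.
Proof. by rewrite (@derive_coord _ _ _ _ id) ?derive_id. Qed.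

Lemma vcoord0 : vcoord (0 : 'rV[R]_2) = 0.
Proof. by rewrite /vcoord mxE. Qed.

Lemma vcoord_ev : vcoord (ev : 'rV[R]_2) = 1.
Proof. by rewrite /vcoord mxE. Qed.

Lemma smooth_vcoord : smooth_on U (@vcoord R).
Proof. by apply: smooth_coord => //; exact: smooth_id. Qed.

(** Division by [v] is possible off the axis, and continuity covers the axis. It shows that [phi] is
    tangent although only [v phi] is a derivative of the map. *)
Lemma tangent_off_axis (phi : 'rV[R]_2 -> 'rV[R]_3) : smooth_on U phi ->
  (forall z, U z -> vcoord z * dot (phi z) (n z) = 0) ->
  forall z, U z -> dot (phi z) (n z) = 0.
Proof.
move=> Cphi vphi z Uz; apply: (@eq0_off_axis _ (fun z => dot (phi z) (n z))).
  by apply: (smooth_continuous _ Uz); exact: smooth_dot.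
have : nbhs z U by exact: open_nbhs_nbhs.
apply: filterS => y Uy vy; apply: (mulfI vy).
by rewrite mulr0 vphi.
Qed.

Lemma smooth_enorm_sqr (a : 'rV[R]_2 -> 'rV[R]_3) : smooth_on U a ->
  smooth_on U (fun z => enorm (a z) ^+ 2).
Proof.
move=> Ca; apply: (smooth_ext oU (g := fun z => dot (a z) (a z))).
  by move=> z _; rewrite enorm_sqr.
exact: smooth_dot.
Qed.

(** * Singular points of the first kind *)

Section FirstKind.
Context {phi : 'rV[R]_2 -> 'rV[R]_3} (Cphi : smooth_on U phi).
Hypothesis gv : forall z, U z -> pv g z = vcoord z *: phi z.
Hypothesis indep : forall z, U z -> row_free (rows3 (pu g z) (phi z) (n z)).

Lemma phi_normal1 z : U z -> dot (phi z) (n z) = 0.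
Proof.
move: z; apply: tangent_off_axis => // z Uz.
by rewrite -dotZl -gv//; exact: orth_n.
Qed.

Lemma pv_g0 : pv g 0 = 0.
Proof. by rewrite gv// vcoord0 scale0r. Qed.

Lemma tD_det z : U z -> tD g phi z = det3 (pu g z) (phi z) (n z) ^+ 2.
Proof.
move=> Uz; rewrite /tD /tE /tG /tF !enorm_sqr; apply: gram_eq_det3.
- exact: orth_n.
- exact: phi_normal1.
- exact: unit_n.
Qed.

Lemma tD_gt0 z : U z -> 0 < tD g phi z.
Proof.
move=> Uz; rewrite tD_det// lt_neqAle eq_sym sqrf_eq0 sqr_ge0 andbT.
by apply: det3_neq0; exact: indep.
Qed.

(** If [tE] vanished, the positive [tD] would be the negative of a square. *)
Lemma tE_gt0 z : U z -> 0 < tE g z.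
Proof.
move=> /tD_gt0; rewrite /tD => D0; rewrite lt_neqAle sqr_ge0 andbT.
apply: contraTneq D0 => <-; rewrite mul0r sub0r -leNgt oppr_le0.
exact: sqr_ge0.
Qed.

Let Cgu : smooth_on U (pu g) := smooth_derive eu Cg.
Let Cgv : smooth_on U (pv g) := smooth_derive ev Cg.
Let Cnu : smooth_on U (pu n) := smooth_derive eu Cn.
Let Cnv : smooth_on U (pv n) := smooth_derive ev Cn.

Lemma smooth_tD : smooth_on U (tD g phi).
Proof.
apply: (smoothB oU); last by apply: smoothX => //; exact: smooth_dot.
by apply: smoothM => //; exact: smooth_enorm_sqr.
Qed.

Lemma smooth_tA : smooth_on U (tA g n phi).
Proof.
have Cv := smooth_vcoord.
have CL : smooth_on U (tL g n) by apply: smoothN => //; exact: smooth_dot.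
have CM : smooth_on U (tM n phi) by apply: smoothN => //; exact: smooth_dot.
have CN : smooth_on U (tN n phi) by apply: smoothN => //; exact: smooth_dot.
apply: (smoothD oU); last first.
  by apply: smoothM => //; apply: smoothM => //; exact: smooth_enorm_sqr.
apply: smoothB => //; first by apply: smoothM => //; exact: smooth_enorm_sqr.
apply: smoothM => //; apply: smoothM => //; last exact: smooth_dot.
by apply: smoothM => //; exact: smooth_cst.
Qed.

Lemma smooth_tQ : smooth_on U (tQ g n phi).
Proof.
have Cv := smooth_vcoord.
have CL : smooth_on U (tL g n) by apply: smoothN => //; exact: smooth_dot.
have CM : smooth_on U (tM n phi) by apply: smoothN => //; exact: smooth_dot.
have CN : smooth_on U (tN n phi) by apply: smoothN => //; exact: smooth_dot.
apply: (smoothB oU); first exact: smoothM.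
by apply: smoothM => //; exact: smoothX.
Qed.

Lemma tA0 : tA g n phi 0 = tE g 0 * tN n phi 0.
Proof. by rewrite /tA vcoord0 !(mulr0, mul0r) subr0 addr0. Qed.

Lemma tQ0 : tQ g n phi 0 = tL g n 0 * tN n phi 0.
Proof. by rewrite /tQ vcoord0 mul0r subr0. Qed.

(** At the origin [n_v] is orthogonal to [n], and to [g_u] by symmetry because [g_v = 0] there. If
    [tN] vanished, it would be orthogonal to [phi] too, hence zero. *)
Lemma tN0_neq0 : pv n 0 != 0 -> tN n phi 0 != 0.
Proof.
apply: contra => /eqP N0; apply/eqP.
apply: (orthogonal_eq0 (det3_neq0 (indep U0))).
- rewrite dotC [LHS](@second_form_sym 0 eu ev)// -/(pv g 0) pv_g0 dot0l //.
- by rewrite dotC; apply/eqP; rewrite -oppr_eq0; apply/eqP.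
- exact: normal_derive.
Qed.

Lemma tN_derive z : U z -> tN n phi z = dot (n z) (pv phi z).
Proof.
move=> Uz; rewrite dotC.
by rewrite [RHS](tangent_derive ev Cphi phi_normal1 Uz).
Qed.

Lemma lambda_off_axis z : U z ->
  lambda g n z = vcoord z * det3 (pu g z) (phi z) (n z).
Proof. by move=> Uz; rewrite /lambda gv// det3Zm. Qed.

(** Since [lambda] is [v] times the determinant of [g_u, phi, n], its [v]-derivative on the axis is
    that determinant. *)
Lemma eta_lambda0 : 'd (lambda g n) (0 : 'rV[R]_2) ev = det3 (pu g 0) (phi 0) (n 0).
Proof.
have Cd : smooth_on U (fun z => det3 (pu g z) (phi z) (n z)) by exact: smooth_det3.
have Cl : smooth_on U (lambda g n) by exact: (smooth_det3 oU Cgu Cgv Cn).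
rewrite -deriveE; last exact: smooth_differentiable Cl U0.
rewrite (near_eqD_on _ U0 lambda_off_axis) derive_mul.
- by rewrite derive_vcoord vcoord_ev vcoord0 mul0r addr0 mul1r.
- exact: differentiable_vcoord.
- exact: smooth_differentiable Cd U0.
Qed.

Lemma derive_axis_scale (a : 'rV[R]_2 -> 'rV[R]_3) z : smooth_on U a -> U z ->
  pv (fun z => vcoord z *: a z) z = a z + vcoord z *: pv a z.
Proof.
move=> Ca Uz; rewrite /pv derive_scale.
- by rewrite derive_vcoord vcoord_ev scale1r.
- exact: differentiable_vcoord.
- exact: smooth_differentiable Ca Uz.
Qed.

(** From [g_v = v phi] follow [g_vv = phi + v phi_v] and [g_vvv = 2 phi_v + v phi_vv]. *)
Lemma pv3_g0 : pv (pv (pv g)) 0 = 2 *: pv phi 0.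
Proof.
have gvv z : U z -> pv (pv g) z = phi z + vcoord z *: pv phi z.
  by move=> Uz; rewrite -derive_axis_scale//; exact: near_eqD_on.
have Cphiv : smooth_on U (pv phi) by exact: smooth_derive.
rewrite [LHS](near_eqD_on _ U0 gvv) deriveD; last first.
- by apply/diff_derivable/(smooth_differentiable _ U0); apply: smoothZ => //;
    exact: smooth_vcoord.
- by apply/diff_derivable/(smooth_differentiable _ U0).
rewrite -/(pv phi 0) -[X in _ + X]/(pv (fun z => vcoord z *: pv phi z) 0).
rewrite derive_axis_scale// vcoord0 scale0r addr0.
by rewrite -[2]/(1 + 1) scalerDl scale1r.
Qed.

(** Up to positive factors the left-hand side is [det(g_u, phi, n) det(g_u, phi, phi_v)], which the
    Gram identity turns into [tD] times [dot n phi_v], that is [tD * tN]. *)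
Lemma eta_lambda_kappa_c : exists2 c : R, 0 < c &
  'd (lambda g n) (0 : 'rV[R]_2) ev * kappa_c g phi 0 = c * tA g n phi 0.
Proof.
have D0 := tD_gt0 U0; have E0 := tE_gt0 U0.
have d0 := det3_neq0 (indep U0).
have c0 : 0 < enorm (cross (pu g 0) (phi 0)).
  rewrite sqrtr_gt0; apply: (@dot_gt0 _ _ (n 0)).
  by rewrite dot_cross.
have e0 : 0 < enorm (pu g 0).
  by rewrite lt_neqAle sqrtr_ge0 andbT eq_sym -sqrf_eq0 gt_eqF.
have p0 : 0 < enorm (pu g 0) `^ (3 / 2) by exact: powR_gt0.
have q0 : 0 < enorm (cross (pu g 0) (phi 0)) `^ (5 / 2) by exact: powR_gt0.
(* The powers come from [kappa_c], the 2 from [g_vvv = 2 phi_v], [tD] from the Gram identity, and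
   the division by [tE] from [tA 0 = tE 0 * tN 0]. *)
exists (enorm (pu g 0) `^ (3 / 2) / enorm (cross (pu g 0) (phi 0)) `^ (5 / 2)
  * 2 * tD g phi 0 / tE g 0).
  by rewrite divr_gt0// mulr_gt0// mulr_gt0// divr_gt0.
rewrite eta_lambda0 /kappa_c pv3_g0 det3Zr tA0 [RHS]mulrA divfK ?gt_eqF//.
have DN : tD g phi 0 * tN n phi 0 =
   det3 (pu g 0) (phi 0) (n 0) * det3 (pu g 0) (phi 0) (pv phi 0).
  rewrite (det3_mul_gram _ (orth_n _ U0) (phi_normal1 U0) (unit_n U0)).
  by rewrite tN_derive// /tD /tE /tG !enorm_sqr.
rewrite -[RHS]mulrA DN; move: (_ `^ _) (_ `^ _) (det3 _ _ _) (det3 _ _ _).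
by move=> a b c d; ring.
Qed.

Lemma kappa_nu_first0 : kappa_nu_first g n 0 = tL g n 0 / tE g 0.
Proof.
rewrite /kappa_nu_first /tL /tE; congr (_ / _).
exact: (tangent_derive eu Cgu (fun y Uy => orth_n eu Uy) U0).

Qed.

Lemma first_kind_curvatures : pv n 0 != 0 ->
  let kp := kappa_plus_first g n phi in
  let km := kappa_minus_first g n phi in
  let s := 'd (lambda g n) (0 : 'rV[R]_2) ev * kappa_c g phi 0 in
  [/\ 0 < s -> bounded_smooth kp /\ value_at_origin kp = kappa_nu_first g n 0,
      bounded_smooth kp -> 0 < s,
      bounded_at_origin kp -> unbounded_at_origin km &
      bounded_at_origin km -> unbounded_at_origin kp].
Proof.
move=> nv0 kp km s; have N0 := tN0_neq0 nv0.
have [c c0 sE] : exists2 c : R, 0 < c & s = c * tA g n phi 0.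
  exact: eta_lambda_kappa_c.
have A0 : tA g n phi 0 != 0 by rewrite tA0 mulf_neq0// gt_eqF ?tE_gt0.
have CA := smooth_tA; have CD := smooth_tD; have CQ := smooth_tQ.
have [kpm kmp] := kappa_unbounded oU U0 CA CD CQ tD_gt0 A0.
split => //; rewrite sE pmulr_rgt0//.
- move=> Apos; have [k ext k0] := kappa_plus_extension oU U0 CA CD CQ Apos.
  split; first by exists k.
  (* At the origin [Q / A = (L N) / (E N)], and [N] cancels. *)
  rewrite (value_at_originE ext) k0 kappa_nu_first0 tQ0 tA0.
  by rewrite (mulrC (tL _ _ _)); exact: divff_cancel.
- exact: (kappa_plus_bounded_smooth oU U0 CA CD CQ tD_gt0 A0).
Qed.

End FirstKind.

(** * Singular points of the second kind *)

Section SecondKind.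
Context {eps : R -> R} {phi : 'rV[R]_2 -> 'rV[R]_3}.
Hypotheses (Ceps : smooth_on U (fun z => eps (ucoord z))) (eps0 : eps 0 = 0).
Hypothesis Cphi : smooth_on U phi.
Hypothesis gu : forall z, U z -> pu g z + eps (ucoord z) *: pv g z = vcoord z *: phi z.
Hypothesis indep : forall z, U z -> row_free (rows3 (phi z) (pv g z) (n z)).

Let Cgv : smooth_on U (pv g) := smooth_derive ev Cg.
Let Cgu : smooth_on U (pu g) := smooth_derive eu Cg.
Let Cnu : smooth_on U (pu n) := smooth_derive eu Cn.
Let Cnv : smooth_on U (pv n) := smooth_derive ev Cn.

Lemma pu_g_second z : U z ->
  pu g z = vcoord z *: phi z - eps (ucoord z) *: pv g z.
Proof. by move=> Uz; rewrite -gu// addrK. Qed.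

Lemma phi_normal2 z : U z -> dot (phi z) (n z) = 0.
Proof.
move: z; apply: tangent_off_axis => // z Uz.
rewrite -dotZl -gu// dotDl dotZl [X in X + _]orth_n// [X in _ * X]orth_n//.
by rewrite mulr0 addr0.
Qed.

Lemma hD_gt0 z : U z -> 0 < hD g phi z.
Proof.
move=> Uz; rewrite /hD /hE /hF /hG !enorm_sqr.
rewrite (gram_eq_det3 (phi_normal2 Uz) (orth_n ev Uz) (unit_n Uz)).
by rewrite lt_neqAle eq_sym sqrf_eq0 sqr_ge0 andbT; exact/det3_neq0/indep.
Qed.

Lemma hG_gt0 z : U z -> 0 < hG g z.
Proof.
move=> /hD_gt0; rewrite /hD => D0; rewrite lt_neqAle sqr_ge0 andbT.
apply: contraTneq D0 => <-; rewrite mulr0 sub0r -leNgt oppr_le0.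
exact: sqr_ge0.
Qed.

Let Cv : smooth_on U (@vcoord R) := smooth_vcoord.
Let CL : smooth_on U (hL n phi) := smoothN oU (smooth_dot oU Cphi Cnu).
Let CM : smooth_on U (hM n phi) := smoothN oU (smooth_dot oU Cphi Cnv).
Let CN : smooth_on U (hN g n) := smoothN oU (smooth_dot oU Cgv Cnv).
Let CE : smooth_on U (hE phi) := smooth_enorm_sqr Cphi.
Let CG : smooth_on U (hG g) := smooth_enorm_sqr Cgv.
Let CF : smooth_on U (hF g phi) := smooth_dot oU Cphi Cgv.

Lemma smooth_hD : smooth_on U (hD g phi).
Proof. exact: (smoothB oU (smoothM oU CE CG) (smoothX oU 2 CF)). Qed.

Let CLM : smooth_on U (fun z => hL n phi z + eps (ucoord z) * hM n phi z) :=
  smoothD oU CL (smoothM oU Ceps CM).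

Lemma smooth_hQ : smooth_on U (hQ g n eps phi).
Proof.
exact: (smoothB oU (smoothM oU CLM CN) (smoothM oU Cv (smoothX oU 2 CM))).
Qed.

Lemma smooth_hA : smooth_on U (hA g n eps phi).
Proof.
have C2v := smoothM oU (smooth_cst oU (2 : R)) Cv.
exact: (smoothD oU (smoothB oU (smoothM oU CG CLM)
  (smoothM oU (smoothM oU C2v CF) CM)) (smoothM oU (smoothM oU Cv CE) CN)).
Qed.

Lemma ucoord0 : ucoord (0 : 'rV[R]_2) = 0.
Proof. by rewrite /ucoord mxE. Qed.

Lemma hA0 : hA g n eps phi 0 = hG g 0 * hL n phi 0.
Proof.
by rewrite /hA vcoord0 ucoord0 eps0 !(mulr0, mul0r) subr0 !addr0.
Qed.

Lemma hQ0 : hQ g n eps phi 0 = hL n phi 0 * hN g n 0.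
Proof. by rewrite /hQ vcoord0 ucoord0 eps0 !(mulr0, mul0r) subr0 addr0. Qed.

Lemma pu_g0 : pu g 0 = 0.
Proof. by rewrite pu_g_second// vcoord0 ucoord0 eps0 !scale0r subr0. Qed.

(** As in the first kind, with the roles of the directions exchanged: [eps 0 = 0] makes [eu] the
    null direction at the origin, so [g_u = 0] and [n_u] is orthogonal to [g_v] and [n]. *)
Lemma hL0_neq0 : pu n 0 != 0 -> hL n phi 0 != 0.
Proof.
apply: contra => /eqP L0; apply/eqP.
apply: (orthogonal_eq0 (det3_neq0 (indep U0))).
- by rewrite dotC; apply/eqP; rewrite -oppr_eq0; apply/eqP.
- by rewrite dotC [LHS](second_form_sym ev eu U0) -/(pu g 0) pu_g0 dot0l.
- exact: normal_derive.
Qed.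

Lemma mean_curvature_second z : U z -> vcoord z != 0 ->
  vcoord z * mean_curvature g n z = hA g n eps phi z / (2 * hD g phi z).
Proof.
move=> Uz v0; have D0 := lt0r_neq0 (hD_gt0 Uz).
have S : dot (pv g z) (pu n z) =
    dot (vcoord z *: phi z - eps (ucoord z) *: pv g z) (pv n z).
  by rewrite -(pu_g_second Uz); exact: second_form_sym.
rewrite /mean_curvature (pu_g_second Uz).
rewrite /hA /hD /hE /hF /hG !enorm_sqr in D0 *.
exact: mean_curvature_vectors.
Qed.

(** The right-hand side of [mean_curvature_second] is smooth on all of [U], so it is the extension
    of [v H]; the 2 in [mu_c] cancels the one in its denominator. *)
Lemma mu_cE : mu_c g n = hA g n eps phi 0 / hD g phi 0.
Proof.
have D2 z : U z -> 2 * hD g phi z != 0.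
  by move=> Uz; rewrite mulf_neq0// gt_eqF// hD_gt0.
have ext : smooth_extension (fun z => vcoord z * mean_curvature g n z)
    (fun z => hA g n eps phi z / (2 * hD g phi z)).
  exists U; split => //; last by move=> z Uz vz; rewrite mean_curvature_second.
  apply: smoothM => //; first exact: smooth_hA.
  apply: smoothV => //; apply: smoothM => //; last exact: smooth_hD.
  exact: smooth_cst.
rewrite /mu_c (value_at_originE ext).
by have := D2 0 U0; rewrite mulf_eq0 negb_or => /andP[_ D0]; field.
Qed.

(** An equality of functions, so it can be rewritten twice to reach the second derivative. *)
Lemma curve_derive1 (V : normedModType R) (h : 'rV[R]_2 -> V) :
  ((h \o (fun t : R => t *: eu))^`())%classic = pu h \o (fun t : R => t *: eu).
Proof.
apply/funext => t; rewrite derive1E.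
by have := derive_line h 0 eu t; under eq_fun do rewrite add0r; rewrite add0r.
Qed.

(** On the axis [g_u = - eps g_v]. Two uses of this, with the symmetry of the second form in
    between, give [eps^2 hN] in the numerator, against [eps^2 hG] in the denominator. *)
Lemma curve_kappa_nu_axis t : U (t *: eu) -> eps t != 0 ->
  curve_kappa_nu g n (fun t => t *: eu) t = hN g n (t *: eu) / hG g (t *: eu).
Proof.
move=> Ut e0; rewrite /curve_kappa_nu derive1nS derive1n1 !curve_derive1 /=.
have vt : vcoord (t *: eu : 'rV[R]_2) = 0 by rewrite /vcoord !mxE /= mulr0.
have ut : ucoord (t *: eu : 'rV[R]_2) = t by rewrite /ucoord !mxE /= mulr1.
have gut : pu g (t *: eu) = - eps t *: pv g (t *: eu).
  by rewrite pu_g_second// vt ut scale0r sub0r scaleNr.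
rewrite [X in X / _](tangent_derive eu Cgu (fun y Uy => orth_n eu Uy) Ut).
rewrite enorm_sqr gut !dotZl ![dot _ (_ *: _)]dotC !dotZl.
rewrite [dot _ ('D_eu n _)](second_form_sym ev eu Ut) -/(pu g _) gut dotZl.
rewrite /hG enorm_sqr /hN /pv.
have : dot ('D_ev g (t *: eu)) ('D_ev g (t *: eu)) != 0.
  by have := hG_gt0 Ut; rewrite /hG enorm_sqr => /lt0r_neq0.
move: (dot _ _) (dot _ _) => c d c0.
by field; rewrite e0 c0.
Qed.

Lemma curve_kappa_nu_lim : hL n phi 0 != 0 -> (\forall t \near (0 : R)^', eps t != 0) ->
  curve_kappa_nu g n (fun t => t *: eu) t @[t --> (0 : R)^'] -->
  hQ g n eps phi 0 / hA g n eps phi 0.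
Proof.
move=> L0 epsn0.
(* At the origin [Q / A = (L N) / (G L)], so the value of the extension is that of the continuous
   function [hN / hG]. *)
have -> : hQ g n eps phi 0 / hA g n eps phi 0 = hN g n 0 / hG g 0.
  by rewrite hA0 hQ0; exact: divff_cancel.
have ceu := @cvg_axis R.
have cq : {for 0, continuous (fun z => hN g n z / hG g z)}.
  have cV : {for 0, continuous (fun z => (hG g z)^-1)}.
    by apply: (cvgV _ (smooth_continuous CG U0)); rewrite gt_eqF ?hG_gt0.
  exact: cvgM (smooth_continuous CN U0) cV.
have nU : \forall t \near (0 : R)^', U (t *: eu).
  by apply: ceu; exact: open_nbhs_nbhs.
apply: cvg_trans (cvg_comp _ _ ceu cq); apply: near_eq_cvg.
by apply: filterS2 nU epsn0 => t Ut et; rewrite /= curve_kappa_nu_axis.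
Qed.

Lemma second_kind_curvatures : pu n 0 != 0 ->
  let kp := kappa_plus_second g n eps phi in
  let km := kappa_minus_second g n eps phi in
  [/\ 0 < mu_c g n -> bounded_smooth kp /\
        ((\forall t \near (0 : R)^', eps t != 0) ->
         curve_kappa_nu g n (fun t => t *: eu) t @[t --> (0 : R)^'] -->
           value_at_origin kp),
      bounded_smooth kp -> 0 < mu_c g n,
      bounded_at_origin kp -> unbounded_at_origin km &
      bounded_at_origin km -> unbounded_at_origin kp].
Proof.
move=> nu0 kp km; have L0 := hL0_neq0 nu0.
have A0 : hA g n eps phi 0 != 0 by rewrite hA0 mulf_neq0// gt_eqF ?hG_gt0.
have CA := smooth_hA; have CD := smooth_hD; have CQ := smooth_hQ.
have [kpm kmp] := kappa_unbounded oU U0 CA CD CQ hD_gt0 A0.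
split => //; rewrite mu_cE pmulr_lgt0 ?invr_gt0 ?hD_gt0//.
- move=> Apos; have [k ext k0] := kappa_plus_extension oU U0 CA CD CQ Apos.
  split; first by exists k.
  by rewrite (value_at_originE ext) k0; exact: curve_kappa_nu_lim.
- exact: (kappa_plus_bounded_smooth oU U0 CA CD CQ hD_gt0 A0).
Qed.

End SecondKind.
End LocalFront.

(** * Vectors and directional derivatives in the plane *)

Section PlaneVectors.
Context {R : realType}.
Implicit Types w : 'rV[R]_2.

Lemma plane_vectorE w : w = ucoord w *: eu + vcoord w *: ev.
Proof.
rewrite {1}(row_sum_delta w) !big_ord_recl big_ord0 addr0 /ucoord /vcoord.
by congr (w _ _ *: delta_mx _ _ + w _ _ *: delta_mx _ _); exact: val_inj.
Qed.

Lemma axis_vectors_dependent (a b : 'rV[R]_2) : vcoord a = 0 -> vcoord b = 0 ->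
  ucoord b *: a + (- ucoord a) *: b = 0.
Proof.
move=> a0 b0; rewrite (plane_vectorE (_ + _)).
have -> : ucoord (ucoord b *: a + - ucoord a *: b) = 0.
  by rewrite {1}/ucoord !mxE -/(ucoord a) -/(ucoord b); ring.
have -> : vcoord (ucoord b *: a + - ucoord a *: b) = 0.
  by rewrite /vcoord !mxE -/(vcoord a) -/(vcoord b) a0 b0 !mulr0 addr0.
by rewrite !scale0r addr0.
Qed.

Lemma ev_neq0 : (ev : 'rV[R]_2) != 0.
Proof. by apply/eqP => /(congr1 (@vcoord R))/eqP; rewrite vcoord_ev vcoord0 oner_eq0. Qed.

Lemma eu_neq0 : (eu : 'rV[R]_2) != 0.
Proof. by apply/eqP => /(congr1 (@ucoord R))/eqP; rewrite /ucoord !mxE oner_eq0. Qed.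

Lemma derive_plane (V : normedModType R) (h : 'rV[R]_2 -> V) z w :
  differentiable h z -> 'D_w h z = ucoord w *: pu h z + vcoord w *: pv h z.
Proof.
move=> dh; rewrite /pu /pv !deriveE//.
by rewrite {1}(plane_vectorE w) linearD !linearZ.
Qed.

Lemma row_free_col_mx_eq0 n (u v : 'rV[R]_n) (a b : R) :
  row_free (col_mx u v) -> a *: u + b *: v = 0 -> a = 0 /\ b = 0.
Proof.
move=> /row_free_inj inj E0.
have /inj E : row_mx (a%:M : 'M[R]_1) (b%:M : 'M[R]_1) *m col_mx u v = 0 *m col_mx u v.
  by rewrite mul_row_col !mul_scalar_mx E0 mul0mx.
move: E; rewrite -row_mx0 => /eq_row_mx[/matrixP/(_ 0 0) + /matrixP/(_ 0 0)].
by rewrite !mxE /= !mulr1n.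
Qed.

Lemma derive_ucoord (z w : 'rV[R]_2) : 'D_w (@ucoord R) z = ucoord w.
Proof. by rewrite (@derive_coord _ _ _ _ id) ?derive_id. Qed.

(** Repeats the induction of [Ck_comp] with the one-variable chain rule, since the inner map is
    scalar-valued and [eps] is smooth only on the projection of [U]. *)
Lemma smooth_comp_ucoord (U : set 'rV[R]_2) (eps : R -> R) : open U ->
  smooth_on ((@ucoord R) @` U) eps -> smooth_on U (fun z => eps (ucoord z)).
Proof.
move=> oU Ce k; have {Ce} := Ce k.
have du z : differentiable (@ucoord R) z by exact: differentiable_coord.
have Uu z : U z -> ((@ucoord R) @` U) (ucoord z) by exists z.
elim: k eps => [|k IH] eps.
  move=> Ce z Uz; apply: (@continuous_comp _ _ _ (@ucoord R) eps).
    exact: coord_continuous.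
  by apply: Ce; exact: Uu.
move=> [de Ce]; split=> [z Uz|w].
  by apply: (@differentiable_comp _ _ _ _ (@ucoord R) eps) => //; exact/de/Uu.
apply: (Ck_ext oU (g := fun z => ucoord w * 'D_1 eps (ucoord z))).
  move=> z Uz; rewrite [RHS](derive_comp1 w (du z) (de _ (Uu _ Uz))).
  by rewrite derive_ucoord.
by apply: CkM => //; [exact: Ck_cst|exact: (IH _ (Ce 1))].
Qed.

End PlaneVectors.

(** * Passing from the front to a chart *)

Section Transport.
Context {R : realType}.

Lemma diffeo_sym (W : normedModType R) (U V : set W) (x y : W -> W) :
  diffeo U V x y -> diffeo V U y x.
Proof. by move=> [[? ?] [? ?] ? ?]; split. Qed.

Lemma diffeo_derive (W : normedModType R) (U V : set W) (x y : W -> W) z w :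
  diffeo U V x y -> U z -> 'd y (x z) ('d x z w) = w.
Proof.
move=> [[oU oV] [Cx Cy] xU _] Uz; have [Vx yx] := xU z Uz.
have dx := smooth_differentiable Cx Uz.
have dy := smooth_differentiable Cy Vx.
apply: etrans (esym (congr1 (fun F => F w) (diff_comp dx dy))) _.
apply: etrans (esym (deriveE w (differentiable_comp dx dy))) _.
rewrite (near_eqD (g := id)) ?derive_id//.
have : nbhs z U by exact: open_nbhs_nbhs.
by apply: filterS => t /xU[].
Qed.

Lemma immersion_comp (W V : normedModType R) (x : W -> W) (h : W -> V) z :
  differentiable x z -> differentiable h (x z) -> injective ('d x z) ->
  immersion_at h (x z) -> immersion_at (h \o x) z.
Proof.
move=> dx dh ix ih; rewrite /immersion_at diff_comp//; exact: inj_comp.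
Qed.

Context {Sigma : set 'rV[R]_2} {f nu : 'rV[R]_2 -> 'rV[R]_3} {p : 'rV[R]_2}.
Context {U V : set 'rV[R]_2} {x y : 'rV[R]_2 -> 'rV[R]_2}.
Hypotheses (frontf : front Sigma f nu) (chartx : oriented_chart Sigma p U V x y).

Lemma chart_diffeo : diffeo U V x y. Proof. by have [] := chartx. Qed.

Lemma chart_open : open U. Proof. by have [[[]]] := chartx. Qed.

Lemma chart_origin : U 0. Proof. by have [_ []] := chartx. Qed.

Lemma chart_target z : U z -> Sigma (x z).
Proof. by have [[_ _ xU _] _ VS _] := chartx; move=> /xU[/VS]. Qed.

Lemma chart_smooth (h : 'rV[R]_2 -> 'rV[R]_3) :
  smooth_on Sigma h -> smooth_on U (h \o x).
Proof.
have [[[oU oV] [Cx _] xU _] _ VS _] := chartx.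
move=> Ch k; apply: (Ck_comp oU (V := V)) => //.
  by move=> z /xU[].
exact: (smooth_subset VS Ch).
Qed.

Lemma chart_derive (h : 'rV[R]_2 -> 'rV[R]_3) z w : smooth_on Sigma h -> U z ->
  'D_w (h \o x) z = 'd h (x z) ('d x z w).
Proof.
have [[[oU oV] [Cx _] xU _] _ VS _] := chartx.
move=> Ch Uz; have dx := smooth_differentiable Cx Uz.
have dh : differentiable h (x z).
  by apply: (smooth_differentiable Ch); exact: chart_target.
apply: etrans (deriveE w (differentiable_comp dx dh)) _.
exact: (congr1 (fun F => F w) (diff_comp dx dh)).
Qed.

Lemma chart_smooth_f : smooth_on U (f \o x).
Proof. by apply: chart_smooth; have [[]] := frontf. Qed.

Lemma chart_smooth_nu : smooth_on U (nu \o x).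
Proof. by apply: chart_smooth; have [[]] := frontf. Qed.

Lemma chart_unit z : U z -> dot ((nu \o x) z) ((nu \o x) z) = 1.
Proof. by have [[_ _ H] _] := frontf; move=> /chart_target/H[]. Qed.

Lemma chart_orth z w : U z -> dot ('D_w (f \o x) z) ((nu \o x) z) = 0.
Proof.
have [[Cf _ H] _] := frontf; move=> Uz; rewrite chart_derive//.
by have [_] := H _ (chart_target Uz); exact.
Qed.

Lemma chart_injective z : U z -> injective ('d x z).
Proof. by move=> Uz; apply: can_inj => w; exact: diffeo_derive chart_diffeo Uz. Qed.

(** A vector killed by both differentials is sent by the chart into the kernel of the differential
    of [(f, nu)]. The immersion condition of a front enters here. *)
Lemma chart_front z w : U z ->
  'D_w (f \o x) z = 0 -> 'D_w (nu \o x) z = 0 -> w = 0.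
Proof.
have [[Cf Cnu _] imm] := frontf; move=> Uz; have Sx := chart_target Uz.
rewrite !chart_derive// => f0 n0.
have := imm _ Sx; rewrite /immersion_at => inj.
apply: (chart_injective Uz); rewrite linear0.
have df := smooth_differentiable Cf Sx.
have dn := smooth_differentiable Cnu Sx.
apply: inj; rewrite linear0.
apply: etrans (congr1 (fun F => F ('d x z w)) (diff_pair df dn)) _.
transitivity (0 : 'rV[R]_3, 0 : 'rV[R]_3); last by [].
move: f0 n0; move: ('d x z w) => v f0 n0.
exact: (f_equal2 (@pair 'rV[R]_3 'rV[R]_3) f0 n0).
Qed.


Lemma chart_derive_inv z : U z -> cancel ('d y (x z)) ('d x z).
Proof.
have [_ _ xU _] := chart_diffeo; move=> Uz w; have [Vx yx] := xU z Uz.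
by have := diffeo_derive w (diffeo_sym chart_diffeo) Vx; rewrite yx.
Qed.

Lemma chart_derive_f z w : U z ->
  'd f (x z) w = 'D_('d y (x z) w) (f \o x) z.
Proof.
move=> Uz; have Cf : smooth_on Sigma f by have [[]] := frontf.
by apply: esym; rewrite chart_derive// (chart_derive_inv Uz) ?inE.
Qed.

(** The differential of the chart is invertible, so singular points of [f] correspond to points of
    the axis. *)
Lemma chart_immersion z : U z ->
  immersion_at (f \o x) z <-> immersion_at f (x z).
Proof.
move=> Uz; have Cf : smooth_on Sigma f by have [[]] := frontf.
have dx : differentiable x z.
  by have [_ [Cx _] _ _] := chart_diffeo; exact: smooth_differentiable Cx Uz.
have dG : differentiable (f \o x) z := smooth_differentiable chart_smooth_f Uz.
split=> [iG|]; last first.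
  apply: immersion_comp => //; last exact: chart_injective.
  exact: smooth_differentiable Cf (chart_target Uz).
move=> a b ab.
have /iG yab : 'd (f \o x) z ('d y (x z) a) = 'd (f \o x) z ('d y (x z) b).
  apply: etrans (esym (deriveE _ dG)) _; apply: etrans (deriveE _ dG).
  exact: etrans (esym (chart_derive_f a Uz)) (etrans ab (chart_derive_f b Uz)).
exact: (can_inj (chart_derive_inv Uz)).
Qed.

(** Every choice of singular curve and null field has to be excluded. Seen in the chart, the curve
    runs in the axis and the null vector is horizontal by hypothesis, so the two cannot be
    independent. *)
Lemma not_first_kind_tangent z : U z ->
  (forall z', U z' -> ~ immersion_at (f \o x) z' <-> vcoord z' = 0) ->
  (forall w, 'D_w (f \o x) z = 0 -> vcoord w = 0) ->
  ~ first_kind Sigma f nu (x z).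
Proof.
move=> Uz axis ker [_ [e [c [eta [[[e0 Cc] c0 c'n0 curve] [_ null] free]]]]].
have [[_ oV] [_ Cy] xU yV] := chart_diffeo.
have [Vx yx] := xU z Uz.
have I0 : `]-e, e[%classic 0 by rewrite /= in_itv/= oppr_lt0 e0.
have oI : open `]-e, e[%classic by exact: interval_open.
have dc : differentiable c 0 := smooth_differentiable Cc I0.
have dy : differentiable y (c 0).
  by rewrite c0; exact: smooth_differentiable Cy Vx.
pose a := 'd y (x z) ((c^`())%classic 0).
pose b := 'd y (x z) (eta 0).
have b0 : vcoord b = 0.
  apply: ker; rewrite -chart_derive_f//.
  by have [_] := null 0 I0; rewrite c0.
have a0 : vcoord a = 0.
  have -> : a = 'D_1 (y \o c) 0.
    rewrite /a -c0 derive1E (deriveE _ dc); apply: esym.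
    apply: etrans (deriveE _ (differentiable_comp dc dy)) _.
    exact: (congr1 (fun F => F 1) (diff_comp dc dy)).
  rewrite /vcoord -derive_coord; last exact: differentiable_comp.
  (* For small [t] the point [c t] is singular and lies in [V], so [y (c t)] is on the axis: the
     second coordinate of [y \o c] vanishes near 0, and so does its derivative. *)
  have cc : c @ (0 : R) --> x z.
    by rewrite -c0; exact: differentiable_continuous.
  have nV : nbhs (x z) V by exact: open_nbhs_nbhs.
  have nI : nbhs (0 : R) `]-e, e[%classic by exact: open_nbhs_nbhs.
  rewrite (near_eqD (g := fun=> 0)) ?derive_cst//.
  have nVc : \forall t \near (0 : R), V (c t) by exact: (cc _ nV).
  have nSc : \forall t \near (0 : R), singular_set Sigma f (c t) <->
      exists2 s, `]-e, e[%classic s & c s = c t by exact: (cc _ curve).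
  apply: filterS3 nI nVc nSc => t It Vc [_ sing].
  have [|Sct nimm] := sing; first by exists t.
  have [Uyc xyc] := yV _ Vc.
  by apply/(axis _ Uyc) => /(chart_immersion Uyc); rewrite xyc.
(* Independence makes both coefficients vanish; in particular [ucoord a = 0], so [a = 0], against
   the non-zero velocity of the curve. *)
have E0 : ucoord b *: (c^`())%classic 0 + (- ucoord a) *: eta 0 = 0.
  have dy_inj := can_inj (chart_derive_inv Uz); apply: dy_inj.
  rewrite linearD !linearZ linear0 -/a -/b.
  exact: axis_vectors_dependent.
have [_ /eqP] := row_free_col_mx_eq0 free E0; rewrite oppr_eq0 => /eqP ua.
have : a = 0 by rewrite (plane_vectorE a) ua a0 !scale0r addr0.
rewrite -[RHS](linear0 ('d y (x z))) => /(can_inj (chart_derive_inv Uz)) c'0.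
by have := c'n0 0 I0; rewrite c'0 eqxx.
Qed.


(** If [eps t = 0], then at [t *: eu] the derivative [g_u] vanishes and [g_v] does not, so the
    kernel is tangent to the axis. For small [t != 0] this contradicts admissibility, the point
    being singular and distinct from [p]. *)
Lemma admissible_eps_neq0 eps phi : admissible Sigma f nu p ->
  adapted_second U (f \o x) (nu \o x) eps phi ->
  \forall t \near (0 : R)^', eps t != 0.
Proof.
move=> [_ firstp] [_ [axis _] _ H]; have U0 := chart_origin.
have [[oU _] [Cx _] xU _] := chart_diffeo.
have x0 : x 0 = p by have [_ []] := chartx.
have nU : \forall t \near (0 : R)^', U (t *: eu).
  by apply: cvg_axis; exact: open_nbhs_nbhs.
have cx : x @ (0 : 'rV[R]_2) --> p.
  by rewrite -x0; exact: (smooth_continuous Cx U0).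
have nfirst : \forall t \near (0 : R)^', singular_set Sigma f (x (t *: eu)) ->
    x (t *: eu) != p -> first_kind Sigma f nu (x (t *: eu)).
  have := cvg_comp _ _ cvg_axis cx; move=> /(_ _ firstp).
  exact.
have n0 : \forall t \near (0 : R)^', t != 0 by exact: nbhs_dnbhs_neq.
apply: filterS3 nU nfirst n0 => t Ut tfirst t0; apply/eqP => et.
have vt : vcoord (t *: eu : 'rV[R]_2) = 0 by rewrite /vcoord !mxE /= mulr0.
have ut : ucoord (t *: eu : 'rV[R]_2) = t by rewrite /ucoord !mxE /= mulr1.
have [_ guv free] := H _ Ut.
have gu : pu (f \o x) (t *: eu) = 0.
  by move: guv; rewrite ut et vt !scale0r addr0.
have gv : pv (f \o x) (t *: eu) != 0.
  apply: contraNneq (det3_neq0 free) => gv.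
  by rewrite gv -(scale0r 0) det3Zm mul0r.
apply: (not_first_kind_tangent Ut axis).
  move=> w; rewrite derive_plane; last exact: (smooth_differentiable chart_smooth_f Ut).
  by rewrite gu scaler0 add0r => /eqP; rewrite scaler_eq0 (negPf gv) orbF => /eqP.
apply: tfirst.
  split; first exact: chart_target.
  have nimm := (axis _ Ut).2 vt.
  exact: (contra_not (chart_immersion Ut).2 nimm).
apply: contra_neq t0 => xt.
have := (xU _ Ut).2; rewrite xt -x0 (xU _ U0).2 => /(congr1 (@ucoord R)).
by rewrite ut /ucoord mxE.
Qed.

Lemma chart_normal_derive_neq0 w : w != 0 -> 'D_w (f \o x) 0 = 0 ->
  'D_w (nu \o x) 0 != 0.
Proof.
move=> w0 fw; apply: contra_neq w0; exact: chart_front chart_origin fw.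
Qed.

Let oU := chart_open.
Let U0 := chart_origin.
Let Cg := chart_smooth_f.
Let Cn := chart_smooth_nu.

Lemma adapted_first_curvatures phi :
  adapted_first U (f \o x) (nu \o x) phi ->
  let kp := kappa_plus_first (f \o x) (nu \o x) phi in
  let km := kappa_minus_first (f \o x) (nu \o x) phi in
  let s := 'd (lambda (f \o x) (nu \o x)) (0 : 'rV[R]_2) ev *
    kappa_c (f \o x) phi 0 in
  [/\ 0 < s -> bounded_smooth kp /\
        value_at_origin kp = kappa_nu_first (f \o x) (nu \o x) 0,
      bounded_smooth kp -> 0 < s,
      bounded_at_origin kp -> unbounded_at_origin km &
      bounded_at_origin km -> unbounded_at_origin kp].
Proof.
move=> [_ Cphi H].
have gv z : U z -> pv (f \o x) z = vcoord z *: phi z by move=> /H[].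
apply: (first_kind_curvatures oU U0 Cg Cn chart_unit chart_orth Cphi gv).
  by move=> z /H[].
by apply: chart_normal_derive_neq0; [exact: ev_neq0|exact: (pv_g0 U0 gv)].
Qed.

Lemma adapted_second_curvatures eps phi :
  adapted_second U (f \o x) (nu \o x) eps phi ->
  let kp := kappa_plus_second (f \o x) (nu \o x) eps phi in
  let km := kappa_minus_second (f \o x) (nu \o x) eps phi in
  [/\ 0 < mu_c (f \o x) (nu \o x) -> bounded_smooth kp /\
        (admissible Sigma f nu p ->
         curve_kappa_nu (f \o x) (nu \o x) (fun t => t *: eu) t
           @[t --> (0 : R)^'] --> value_at_origin kp),
      bounded_smooth kp -> 0 < mu_c (f \o x) (nu \o x),
      bounded_at_origin kp -> unbounded_at_origin km &
      bounded_at_origin km -> unbounded_at_origin kp].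
Proof.
move=> H2 kp km; have [[Ceps eps0] _ Cphi H] := H2.
have gu z : U z -> pu (f \o x) z + eps (ucoord z) *: pv (f \o x) z =
    vcoord z *: phi z by move=> /H[].
have free z : U z -> row_free (rows3 (phi z) (pv (f \o x) z) ((nu \o x) z)).
  by move=> /H[].
have nu0 : pu (nu \o x) 0 != 0.
  by apply: chart_normal_derive_neq0; [exact: eu_neq0|exact: (pu_g0 U0 eps0 gu)].
(* The local results take [eps] as a function on [U], through the first coordinate. *)
have Ceu := smooth_comp_ucoord oU Ceps.
have [H1 ? ? ?] := second_kind_curvatures oU U0 Cg Cn chart_unit chart_orth
  Ceu eps0 Cphi gu free nu0.
split => // /H1[bkp lim]; split => // adm.
by apply: lim; exact: admissible_eps_neq0 adm H2.
Qed.

End Transport.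

Theorem theorem3p1 (R : realType) (Sigma : set 'rV[R]_2)
    (f nu : 'rV[R]_2 -> 'rV[R]_3) (p : 'rV[R]_2)
    (U V : set 'rV[R]_2) (x y : 'rV[R]_2 -> 'rV[R]_2)
    (openSigma : open Sigma) (connectedSigma : connected Sigma)
    (frontf : front Sigma f nu)
    (nondegp : nondegenerate_singular Sigma f nu p)
    (chartx : oriented_chart Sigma p U V x y) :
  let g := f \o x in
  let n := nu \o x in
  [/\ (* cuspidal edge *)
      forall phi : 'rV[R]_2 -> 'rV[R]_3,
        cuspidal_edge f p -> adapted_first U g n phi ->
        let kp := kappa_plus_first g n phi in
        let eta_lambda := 'd (lambda g n) (0 : 'rV[R]_2) ev in
        (0 < eta_lambda * kappa_c g phi 0 ->
           bounded_smooth kp /\ value_at_origin kp = kappa_nu_first g n 0) /\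
        (bounded_smooth kp -> 0 < eta_lambda * kappa_c g phi 0),
      (* second kind *)
      forall (eps : R -> R) (phi : 'rV[R]_2 -> 'rV[R]_3),
        second_kind Sigma f nu p -> adapted_second U g n eps phi ->
        let kp := kappa_plus_second g n eps phi in
        (0 < mu_c g n ->
           bounded_smooth kp /\
           (admissible Sigma f nu p ->
              curve_kappa_nu g n (fun t => t *: eu) t @[t --> 0^']
                --> value_at_origin kp)) /\
        (bounded_smooth kp -> 0 < mu_c g n) &
      (* exactly one of the principal curvatures can be bounded *)
      (forall phi : 'rV[R]_2 -> 'rV[R]_3,
        first_kind Sigma f nu p -> adapted_first U g n phi ->
        let kp := kappa_plus_first g n phi in
        let km := kappa_minus_first g n phi in
        (bounded_at_origin kp -> unbounded_at_origin km) /\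
        (bounded_at_origin km -> unbounded_at_origin kp)) /\
      (forall (eps : R -> R) (phi : 'rV[R]_2 -> 'rV[R]_3),
        second_kind Sigma f nu p -> adapted_second U g n eps phi ->
        let kp := kappa_plus_second g n eps phi in
        let km := kappa_minus_second g n eps phi in
        (bounded_at_origin kp -> unbounded_at_origin km) /\
        (bounded_at_origin km -> unbounded_at_origin kp))].
Proof.
move=> g n; split.
- by move=> phi _ /(adapted_first_curvatures frontf chartx)[].
- by move=> eps phi _ /(adapted_second_curvatures frontf chartx)[].
split.
- by move=> phi _ /(adapted_first_curvatures frontf chartx)[].
- by move=> eps phi _ /(adapted_second_curvatures frontf chartx)[].
Qed.
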